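(* Let $(x_n)_{n\ge0}$ and $(\phi_n)_{n\ge0}$ be computable sequences of real numbers such that $\sum_{n} x_n^2=\infty$, and let $(\varepsilon_n(\alpha))_{n\ge 0}$ be an algorithmically random Rademacher sequence. For $N=1,2,\dots$ and $t\in[0,1]$ let $$\sigma_N(t)=\sum_{n=0}^{N}\left(1-\frac{n}{N}\right)\varepsilon_n(\alpha)\,x_n\cos(2\pi nt+\phi_n).$$ Then $$\limsup_{N\to\infty}\int_0^1|\sigma_N(t)|\,dt=\infty.$$
   Context: Write $\mathcal{N}=\{-1,1\}^{\omega}$ for the space of infinite sequences of $\pm1$. For $\alpha\in\mathcal{N}$ let $\overline{\alpha}(n)$ be its initial segment of length $n$. $K$ denotes (prefix-free, i.e. self-delimiting) Kolmogorov complexity of finite strings. A sequence $\alpha\in\mathcal{N}$ is Kolmogorov-Chaitin complex if there is $k$ such that $K(\overline{\alpha}(n))\ge n-k$ for all $n$; the set of such $\alpha$ is denoted $KC$. A sequence $(\varepsilon_n(\alpha))$ is an algorithmically random Rademacher sequence if $\alpha\in KC$ and $\varepsilon_n(\alpha)\in\{-1,1\}$ is the $n$th bit of $\alpha$ for every $n$. A sequence $(x_n)$ of real numbers is a computable sequence if there is an effective way of approximating $x_n$ arbitrarily closely, given $n$. *)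

(* Defs.v *)
From mathcomp Require Import all_boot all_order all_algebra.
From mathcomp Require Import all_classical all_reals all_analysis.
Import Order.TTheory GRing.Theory Num.Theory numFieldNormedType.Exports.

Set Implicit Arguments.
Unset Strict Implicit.
Unset Printing Implicit Defensive.

Local Open Scope classical_set_scope.
Local Open Scope ring_scope.

(** * Partial recursive functions *)

Inductive mu_rec : Type :=
  | Zero
  | Succ
  | Proj of nat
  | Comp of mu_rec & seq mu_rec
  | PrimRec of mu_rec & mu_rec
  | Mu of mu_rec.

(* [mu_eval c v y]: the computation of [c] on the arguments [v] halts with
   value [y].  Arities are not tracked: missing arguments are read as 0 and
   superfluous ones are ignored.  [PrimRec f g] recurses on the first argument,
   [g] receiving the counter, the previous value and the parameters; [Mu f]
   passes the candidate as first argument of [f]. *)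
Fixpoint mu_eval (c : mu_rec) (v : seq nat) (y : nat) {struct c} : Prop :=
  match c with
  | Zero => y = 0%N
  | Succ => y = (head 0%N v).+1
  | Proj i => y = nth 0%N v i
  | Comp f gs =>
      exists2 ws : seq nat,
        (fix evals (gs : seq mu_rec) (ws : seq nat) {struct gs} : Prop :=
           match gs, ws with
           | [::], [::] => True
           | g :: gs', w :: ws' => mu_eval g v w /\ evals gs' ws'
           | _, _ => False
           end) gs ws
        & mu_eval f ws y
  | PrimRec f g =>
      (fix iter_eval (n z : nat) {struct n} : Prop :=
         match n with
         | 0 => mu_eval f (behead v) z
         | n'.+1 =>
             exists2 w, iter_eval n' w & mu_eval g [:: n', w & behead v] z
         end) (head 0%N v) y
  | Mu f =>
      mu_eval f (y :: v) 0%N /\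
      forall z, (z < y)%N -> exists w, mu_eval f (z :: v) w.+1
  end.

Fixpoint mu_eval_functional (c : mu_rec) (v : seq nat) (y z : nat) {struct c} :
  mu_eval c v y -> mu_eval c v z -> y = z.
Proof.
case: c => [||i|f gs|f g|f] /=; try by move=> -> ->.
- move=> [ws Hws Hy] [ws' Hws' Hz].
  suff E : ws = ws' by subst ws'; exact: mu_eval_functional Hy Hz.
  move: ws ws' Hws Hws' {Hy Hz}; move: gs.
  fix IH 1 => -[|g gs] [|w ws] [|w' ws'] //= [Hw Hws] [Hw' Hws'].
  by rewrite (mu_eval_functional _ _ _ _ Hw Hw') (IH _ _ _ Hws Hws').
- elim: (head 0%N v) y z => [|n IHn] y z; first exact: mu_eval_functional.
  move=> [w Hw Hy] [w' Hw' Hz]; move: Hy; rewrite (IHn _ _ Hw Hw') => Hy.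
  exact: mu_eval_functional Hy Hz.
- move=> [Hy ltY] [Hz ltZ].
  have [yz|zy|//] := ltngtP y z.
  + have [w Hw] := ltZ _ yz.
    by have := mu_eval_functional _ _ _ _ Hy Hw.
  + have [w Hw] := ltY _ zy.
    by have := mu_eval_functional _ _ _ _ Hz Hw.
Qed.

Definition computable2 (f : nat -> nat -> nat) : Prop :=
  exists c : mu_rec, forall m n, mu_eval c [:: m; n] (f m n).

(* Computable sequence of reals, in the sense of Pour-El and Richards: a
   computable double sequence of rationals (-1)^s a / b approximates [x n]
   within 2^-k, uniformly in [n] and [k]. *)
Definition computable_sequence (R : realType) (x : nat -> R) : Prop :=
  exists s a b : nat -> nat -> nat,
    [/\ computable2 s, computable2 a, computable2 b,
        forall n k, b n k != 0%N &
        forall n k,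
          `|x n - (-1) ^+ s n k * ((a n k)%:R / (b n k)%:R)| <= 2 ^- k].

(** * Prefix-free Kolmogorov complexity *)

(* Bijective base-2 numeration, a bijection between finite strings and [nat]. *)
Fixpoint string_code (s : seq bool) : nat :=
  if s is b :: s' then ((string_code s').*2 + b.+1)%N else 0%N.

Definition machine_output (M : mu_rec) (p s : seq bool) : Prop :=
  mu_eval M [:: string_code p] (string_code s).

Definition prefix_free_machine (M : mu_rec) : Prop :=
  forall p q s t, machine_output M p s -> machine_output M q t ->
    prefix p q -> p = q.

(* Extended-real valued, being +oo on strings that [M] does not output. *)
Definition complexity (R : realType) (M : mu_rec) (s : seq bool) : \bar R :=
  ereal_inf [set (size p)%:R%:E | p in [set p | machine_output M p s]].

(* The machines [U] for which [complexity U] is the prefix-free Kolmogorov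
   complexity K; it does not depend on [U] up to an additive constant. *)
Definition optimal_prefix_free_machine (R : realType) (U : mu_rec) : Prop :=
  prefix_free_machine U /\
  forall M, prefix_free_machine M ->
    exists c : nat, forall s,
      (complexity R U s <= complexity R M s + c%:R%:E)%E.

(* An element of {-1,1}^omega is represented by [alpha : nat -> bool], where
   [true] stands for 1 and [false] for -1 (see [rademacher]); its initial
   segment of length [n] is [mkseq alpha n]. *)
Definition KC (R : realType) (U : mu_rec) (alpha : nat -> bool) : Prop :=
  exists k : nat, forall n : nat,
    ((n%:R - k%:R)%:E <= complexity R U (mkseq alpha n))%E.

Definition rademacher (R : realType) (alpha : nat -> bool) (n : nat) : R :=
  if alpha n then 1 else -1.

(** * Fejer means of the random Fourier series *)

(* Meaningful for [0 < N]. *)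
Definition sigma (R : realType) (x phi : nat -> R) (alpha : nat -> bool)
    (N : nat) (t : R) : R :=
  \sum_(0 <= n < N.+1)
    (1 - n%:R / N%:R) * rademacher R alpha n * x n
      * cos (2 * pi * n%:R * t + phi n).

(* Main.v *)
Require Import Defs.
From mathcomp Require Import all_boot all_order all_algebra complex.
From mathcomp Require Import zify ring lra.
From mathcomp Require Import all_classical all_reals all_analysis.
Import Order.TTheory GRing.Theory Num.Theory numFieldNormedType.Exports.

Local Open Scope classical_set_scope.
Local Open Scope ring_scope.

(** Let [F_N] be the sum of [(1 - n/N) eps_n x_n exp (i (2 pi n t + phi_n))], of which [sigma_N]
    is the real part.  Its energy [E_N], the sum of the squared moduli of its coefficients, does
    not depend on the signs and tends to infinity with [N], because [x] is not square summable.
    The fourth moment of [F_N] on the circle is, by Parseval's identity for [F_N ^ 2], a quartic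
    form [T_N] in the signs, and the mean of [T_N] over all choices of signs is at most
    [2 E_N ^ 2] ([mean_quartic]).  Integrating [y ^ 2 <= l |y| + y ^ 4 / l ^ 2] with [y = sigma_N]
    bounds the [L^1] norm of [sigma_N] from below in terms of [E_N] and [T_N]
    ([energy_le_L1]): as soon as [T_N <= 2 ^ (2m+1) E_N ^ 2] and [E_N >= 8 ^ m], this norm is at
    least a constant times [2 ^ (m/2)] for large [m].

    It remains to see that an incompressible [alpha] satisfies such inequalities.  For each [m]
    choose the least [N_m >= 2m] with [E_(N_m) >= 8 ^ m].  By Markov's inequality at most
    [2 ^ (N_m - 2m)] sign strings of length [N_m] violate [T <= 2 ^ (2m+1) E ^ 2].  If such a
    violation is decidable, a violating string is described by [m] in unary followed by its rank
    among the violating strings on [N_m - 2m] bits, that is, by a self-delimiting program of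
    length [N_m - m + 1]; so [alpha] violates the inequality for finitely many [m] only
    ([KC_avoids_tests]).

    To make the test decidable, the coefficients [x_n exp (i phi_n)] are first replaced by
    computable dyadic rationals [(P_n + i Q_n) / 2 ^ n] at distance [O (2 ^ -n)]
    ([computable_polar]).  This moves [sigma_N] by a bounded amount uniformly in [N] and [t], and
    after clearing denominators [E_N] and [T_N] become integers given by finite sums of products.
    The phases are computed without power series from the identity
    [(D + i A) ^ (2M) = (D ^ 2 + A ^ 2) ^ M exp (2 i M atan (A / D))], since
    [2 M atan (s / (2M))] is within [s ^ 2 / (2M)] of [s]. *)

(** * Recursive functions of a finite environment *)

(** An environment [e : nat -> nat] lists the arguments, argument [i] being [e i].  Functions of an
environment let binders be written as Rocq lambdas: entering the scope of a new variable shifts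
the old ones from [e] to [fun i => e i.+1], and [(fun i => e i.+1) 0] is convertible to [e 1].
The arity [a] is recorded because a code can copy only a fixed number of arguments. *)
Definition rec (a : nat) (f : (nat -> nat) -> nat) : Prop :=
  exists c : mu_rec, forall v, size v = a -> mu_eval c v (f (nth 0%N v)).

Lemma rec_arg a i : rec a (fun e => e i).
Proof. by exists (Proj i). Qed.

Lemma rec_zero a : rec a (fun=> 0%N).
Proof. by exists Zero. Qed.

Lemma mu_eval_Comp f cs v ws y : size ws = size cs ->
  (forall i, (i < size cs)%N -> mu_eval (nth Zero cs i) v (nth 0%N ws i)) ->
  mu_eval f ws y -> mu_eval (Comp f cs) v y.
Proof.
move=> sz H Hy; exists ws => // {Hy y f}.
elim: cs ws sz H => [|c cs IH] [|w ws] //= [sz] H; split; first exact: (H 0%N).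
by apply: IH => // i lti; exact: (H i.+1).
Qed.

(** The default value 0 beyond [b] is what reading past the end of the list of [b] results gives. *)
Lemma rec_comp a b (f : (nat -> nat) -> nat) (g : nat -> (nat -> nat) -> nat) :
  rec b f -> (forall i, (i < b)%N -> rec a (g i)) ->
  rec a (fun e => f (fun i => if (i < b)%N then g i e else 0%N)).
Proof.
move=> [cf Hf] Hg.
have [|cg Hcg] := @choice _ _ (fun i c => (i < b)%N ->
    forall v, size v = a -> mu_eval c v (g i (nth 0%N v))).
  by move=> i; case: (ltnP i b) => [/Hg[c Hc]|_]; [exists c|exists Zero].
exists (Comp cf (mkseq cg b)) => v sv.
apply: (@mu_eval_Comp _ _ _ (mkseq (fun i => g i (nth 0%N v)) b)).
- by rewrite !size_mkseq.
- move=> i; rewrite size_mkseq => ib; rewrite !nth_mkseq //; exact: Hcg.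
- suff -> : (fun i => if (i < b)%N then g i (nth 0%N v) else 0%N) =
      nth 0%N (mkseq (fun i => g i (nth 0%N v)) b) by apply: Hf; rewrite size_mkseq.
  apply/funext => i; case: ifP => ib; first by rewrite nth_mkseq.
  by rewrite nth_default // size_mkseq leqNgt ib.
Qed.

Lemma rec_call1 a F f : rec 1 (fun e => F (e 0%N)) -> rec a f ->
  rec a (fun e => F (f e)).
Proof. by move=> rF rf; apply: (rec_comp a 1 _ (fun=> f) rF). Qed.

Lemma rec_call2 a F f g : rec 2 (fun e => F (e 0%N) (e 1%N)) ->
  rec a f -> rec a g -> rec a (fun e => F (f e) (g e)).
Proof.
move=> rF rf rg; apply: (rec_comp a 2 _ (nth f [:: f; g]) rF).
by case=> [|[|]].
Qed.

(** [PrimRec] finds its bound in front of the parameters; this puts a computed bound there. *)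
Lemma mu_eval_bind a (n : (nat -> nat) -> nat) c : rec a n ->
  exists c', forall v, size v = a ->
    forall y, mu_eval c (n (nth 0%N v) :: v) y -> mu_eval c' v y.
Proof.
move=> [cn Hn]; exists (Comp c (cn :: mkseq Proj a)) => v sv y Hy.
apply: (mu_eval_Comp _ _ _ _ _ _ _ Hy); first by rewrite /= size_mkseq sv.
case=> [|i]; rewrite /= ?size_mkseq => ia; first exact: Hn.
by rewrite nth_mkseq.
Qed.

(** The closure property from which the arithmetic operations below are derived. *)
Lemma rec_iteri a n f (g : nat -> nat -> (nat -> nat) -> nat) :
  rec a n -> rec a f -> rec a.+2 (fun e => g (e 0%N) (e 1%N) (fun i => e i.+2)) ->
  rec a (fun e => iteri (n e) (fun i w => g i w e) (f e)).
Proof.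
move=> rn [cf Hf] [cg Hg].
have [c Hc] := mu_eval_bind _ _ (PrimRec cf cg) rn.
exists c => v sv; apply: Hc => //=.
elim: (n _) => [|k IHk] /=; first exact: Hf.
by eexists; [exact: IHk|apply: (Hg [:: k, _ & v]); rewrite /= sv].
Qed.

Lemma rec_succ a f : rec a f -> rec a (fun e => (f e).+1).
Proof. by apply: rec_call1; exists Succ => -[|x []]. Qed.

Lemma rec_const a k : rec a (fun=> k).
Proof. by elim: k => [|k /rec_succ //]; exact: rec_zero. Qed.

Lemma rec_pred a f : rec a f -> rec a (fun e => (f e).-1).
Proof.
apply: rec_call1; have := rec_iteri 1 _ _ (fun i _ _ => i)
  (rec_arg _ 0) (rec_zero _) (rec_arg _ 0).
by congr rec; apply/funext => e; case: (e 0%N).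
Qed.

Lemma rec_add a f g : rec a f -> rec a g -> rec a (fun e => (f e + g e)%N).
Proof.
move=> rf rg; have := rec_iteri a _ _ (fun _ w _ => w.+1) rf rg
  (rec_succ _ _ (rec_arg _ 1)).
by congr rec; apply/funext => e; elim: (f e) => //= k ->; rewrite addSn.
Qed.

Lemma rec_sub a f g : rec a f -> rec a g -> rec a (fun e => (f e - g e)%N).
Proof.
move=> rf rg; have := rec_iteri a _ _ (fun _ w _ => w.-1) rg rf
  (rec_pred _ _ (rec_arg _ 1)).
by congr rec; apply/funext => e; elim: (g e) => [|k /= ->]; rewrite ?subn0 ?subnS.
Qed.

Lemma rec_sum a n (g : nat -> (nat -> nat) -> nat) :
  rec a n -> rec a.+1 (fun e => g (e 0%N) (fun i => e i.+1)) ->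
  rec a (fun e => \sum_(i < n e) g i e)%N.
Proof.
move=> rn rg.
have rg' : rec a.+2 (fun e => g (e 0%N) (fun i => e i.+2)).
  pose h i := if i is i'.+1 then fun e : nat -> nat => e i'.+2 else fun e => e 0%N.
  have [|c Hc] := rec_comp a.+2 a.+1 _ h rg; first by case=> *; exact: rec_arg.
  exists c => v sv; move: (Hc v sv); congr (mu_eval _ _ (g _ _)).
  apply/funext => i; rewrite /h; case: ltnP => // ai.
  by rewrite nth_default // sv -ltnS.
have := rec_iteri a _ _ (fun i w e => w + g i e)%N rn (rec_zero _)
  (rec_add _ _ _ (rec_arg _ 1) rg').
congr rec; apply/funext => e; elim: (n e) => [|k /= ->]; first by rewrite big_ord0.
by rewrite big_ord_recr.
Qed.

Lemma rec_mul a f g : rec a f -> rec a g -> rec a (fun e => (f e * g e)%N).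
Proof.
apply: (rec_call2 a muln).
have := rec_iteri 2 _ _ (fun _ w e => w + e 1%N)%N (rec_arg _ 0) (rec_zero _)
  (rec_add _ _ _ (rec_arg _ 1) (rec_arg _ 3)).
by congr rec; apply/funext => e; elim: (e 0%N) => //= k ->; rewrite mulSn addnC.
Qed.

Lemma rec_exp a f g : rec a f -> rec a g -> rec a (fun e => (f e ^ g e)%N).
Proof.
apply: (rec_call2 a expn).
have := rec_iteri 2 _ _ (fun _ w e => w * e 0%N)%N (rec_arg _ 1) (rec_const _ 1)
  (rec_mul _ _ _ (rec_arg _ 1) (rec_arg _ 2)).
by congr rec; apply/funext => e; elim: (e 1%N) => //= k ->; rewrite expnSr.
Qed.

Lemma rec_fact a f : rec a f -> rec a (fun e => (f e)`!)%N.
Proof.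
apply: (rec_call1 a factorial).
have := rec_iteri 1 _ _ (fun i w _ => i.+1 * w)%N (rec_arg _ 0) (rec_const _ 1)
  (rec_mul _ _ _ (rec_succ _ _ (rec_arg _ 0)) (rec_arg _ 1)).
by congr rec; apply/funext => e; elim: (e 0%N) => //= k ->.
Qed.

Lemma rec_eq0 a f : rec a f -> rec a (fun e => (f e == 0)%N).
Proof.
move=> rf; have := rec_sub _ _ _ (rec_const _ 1) rf.
by congr rec; apply/funext => e; case: (f e).
Qed.

Lemma rec_leq a f g : rec a f -> rec a g -> rec a (fun e => f e <= g e)%N.
Proof. by move=> rf rg; exact: rec_eq0 (rec_sub _ _ _ rf rg). Qed.

Lemma rec_ltn a f g : rec a f -> rec a g -> rec a (fun e => f e < g e)%N.
Proof. by move=> rf; exact: rec_leq (rec_succ _ _ rf). Qed.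

Lemma rec_neg a (b : (nat -> nat) -> bool) : rec a b -> rec a (fun e => ~~ b e).
Proof. by move=> /rec_eq0; congr rec; apply/funext => e; case: (b e). Qed.

Lemma rec_and a (b c : (nat -> nat) -> bool) :
  rec a b -> rec a c -> rec a (fun e => b e && c e).
Proof.
move=> rb rc; have := rec_mul _ _ _ rb rc.
by congr rec; apply/funext => e; case: (b e); case: (c e).
Qed.

Lemma rec_eqn a f g : rec a f -> rec a g -> rec a (fun e => f e == g e)%N.
Proof.
move=> rf rg; have := rec_and _ _ _ (rec_leq _ _ _ rf rg) (rec_leq _ _ _ rg rf).
by congr rec; apply/funext => e; rewrite -eqn_leq.
Qed.

Lemma rec_exists a n (g : nat -> (nat -> nat) -> bool) :
  rec a n -> rec a.+1 (fun e => g (e 0%N) (fun i => e i.+1)) ->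
  rec a (fun e => [exists i : 'I_(n e), g i e]).
Proof.
move=> rn rg; have := rec_ltn _ _ _ (rec_zero _) (rec_sum _ _ (fun i e => g i e : nat) rn rg).
congr rec; apply/funext => e; congr nat_of_bool.
rewrite lt0n sum_nat_eq0 negb_forall; apply: eq_existsb => i.
by case: (g i e).
Qed.

(** The quotient counts the positive multiples of the divisor up to the dividend. *)
Lemma rec_div a f g : rec a f -> rec a g -> rec a (fun e => (f e %/ g e)%N).
Proof.
apply: (rec_call2 a divn).
have := rec_mul 2 _ _ (rec_ltn _ _ _ (rec_zero _) (rec_arg _ 1))
  (rec_sum 2 _ (fun i e => i.+1 * e 1 <= e 0)%N (rec_arg _ 0)
    (rec_leq _ _ _ (rec_mul _ _ _ (rec_succ _ _ (rec_arg _ 0)) (rec_arg _ 2))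
      (rec_arg _ 1))).
congr rec; apply/funext => e; case: (posnP (e 1%N)) => [->|d0]; first by rewrite mul0n.
rewrite mul1n -[RHS]muln1 -[in RHS](card_ord (_ %/ _)) -sum_nat_const.
rewrite (big_ord_widen _ (fun=> 1%N) (leq_div (e 0%N) (e 1%N))).
by rewrite [RHS]big_mkcond; apply: eq_bigr => i _; rewrite leq_divRL //; case: leqP.
Qed.

Lemma rec_odd a f : rec a f -> rec a (fun e => odd (f e)).
Proof.
move=> rf; have r2 := rec_const a 2.
have := rec_sub _ _ _ rf (rec_mul _ _ _ (rec_div _ _ _ rf r2) r2).
by congr rec; apply/funext => e; rewrite -modn2 {1}(divn_eq (f e) 2) addKn.
Qed.

(** Unbounded search, for a total function known to return the least witness. *)
Lemma rec_search a (n : (nat -> nat) -> nat) (P : nat -> (nat -> nat) -> bool) :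
  rec a.+1 (fun e => P (e 0%N) (fun i => e i.+1)) ->
  (forall e, P (n e) e) -> (forall e k, P k e -> (n e <= k)%N) -> rec a n.
Proof.
move=> /rec_neg[c Hc] Pn minn; exists (Mu c) => v sv.
have H k : mu_eval c (k :: v) (~~ P k (nth 0%N v)) by apply: Hc; rewrite /= sv.
split; first by have := H (n (nth 0%N v)); rewrite Pn.
move=> z zn; exists 0%N; have := H z.
by case: (P z _) (minn (nth 0%N v) z) => // /(_ isT); rewrite leqNgt zn.
Qed.

(** Integers are handled as formal differences of naturals: ring operations then need no case
analysis on signs. *)
Definition recz (a : nat) (f : (nat -> nat) -> int) : Prop :=
  exists p q, [/\ rec a p, rec a q & forall e, f e = (p e)%:Z - (q e)%:Z].

Lemma recz_nat a f : rec a f -> recz a (fun e => (f e)%:Z).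
Proof.
by move=> rf; exists f, (fun=> 0%N); split=> // [|e]; rewrite ?subr0 //; exact: rec_zero.
Qed.

Lemma recz_call1 a (F : nat -> int) f : recz 1 (fun e => F (e 0%N)) -> rec a f ->
  recz a (fun e => F (f e)).
Proof.
move=> [p [q [rp rq Fpq]]] rf.
exists (fun e => p (fun i => if (i < 1)%N then f e else 0%N)).
exists (fun e => q (fun i => if (i < 1)%N then f e else 0%N)).
split; [exact: (rec_comp _ _ _ (fun=> f) rp)|exact: (rec_comp _ _ _ (fun=> f) rq)|].
by move=> e; exact: (Fpq (fun i => if (i < 1)%N then f e else 0%N)).
Qed.

Lemma recz_call2 a F f g : recz 2 (fun e => F (e 0%N) (e 1%N)) ->
  rec a f -> rec a g -> recz a (fun e => F (f e) (g e)).
Proof.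
move=> [p [q [rp rq Fpq]]] rf rg; pose c i := nth f [:: f; g] i.
have rc : forall i, (i < 2)%N -> rec a (c i) by case=> [|[|]].
exists (fun e => p (fun i => if (i < 2)%N then c i e else 0%N)).
exists (fun e => q (fun i => if (i < 2)%N then c i e else 0%N)).
split; [exact: rec_comp|exact: rec_comp|].
by move=> e; exact: (Fpq (fun i => if (i < 2)%N then c i e else 0%N)).
Qed.

Lemma recz_add a f g : recz a f -> recz a g -> recz a (fun e => f e + g e).
Proof.
move=> [p [q [rp rq fE]]] [p' [q' [rp' rq' gE]]].
exists (fun e => p e + p' e)%N, (fun e => q e + q' e)%N.
by split=> [||e]; rewrite ?fE ?gE ?PoszD; [exact: rec_add..|ring].
Qed.

Lemma recz_opp a f : recz a f -> recz a (fun e => - f e).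
Proof.
by move=> [p [q [rp rq fE]]]; exists q, p; split=> // e; rewrite fE opprB.
Qed.

Lemma recz_mul a f g : recz a f -> recz a g -> recz a (fun e => f e * g e).
Proof.
move=> [p [q [rp rq fE]]] [p' [q' [rp' rq' gE]]].
exists (fun e => p e * p' e + q e * q' e)%N, (fun e => p e * q' e + q e * p' e)%N.
split=> [||e]; [exact: rec_add (rec_mul _ _ _ _ _) (rec_mul _ _ _ _ _)..|].
by rewrite fE gE !PoszD !PoszM; ring.
Qed.

Lemma recz_exp a f n : recz a f -> recz a (fun e => f e ^+ n).
Proof.
move=> rf; elim: n => [|n IH]; first exact: (recz_nat _ _ (rec_const a 1)).
by have := recz_mul _ _ _ rf IH; congr recz; apply/funext => e; rewrite exprS.
Qed.

Lemma recz_sum a n (g : nat -> (nat -> nat) -> int) :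
  rec a n -> recz a.+1 (fun e => g (e 0%N) (fun i => e i.+1)) ->
  recz a (fun e => \sum_(i < n e) g i e).
Proof.
move=> rn [p [q [rp rq gE]]].
pose c e i := fun k => if k is k'.+1 then e k' else i : nat.
have eta (f : (nat -> nat) -> nat) : rec a.+1 f ->
    rec a.+1 (fun e => f (c (fun k => e k.+1) (e 0%N))).
  by congr rec; apply/funext => e; congr f; apply/funext => -[].
exists (fun e => \sum_(i < n e) p (c e i))%N, (fun e => \sum_(i < n e) q (c e i))%N.
split; [exact: (rec_sum a n (fun i e => p (c e i)) rn (eta _ rp))|
  exact: (rec_sum a n (fun i e => q (c e i)) rn (eta _ rq))|].
move=> e; rewrite !(big_morph Posz PoszD (erefl _)) -sumrB.
by apply: eq_bigr => i _; rewrite -gE.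
Qed.

Lemma rec_lez a f g : recz a f -> recz a g -> rec a (fun e => f e <= g e).
Proof.
move=> [p [q [rp rq fE]]] [p' [q' [rp' rq' gE]]].
have := rec_leq _ _ _ (rec_add _ _ _ rp rq') (rec_add _ _ _ rp' rq).
by congr rec; apply/funext => e; rewrite fE gE; congr nat_of_bool; lia.
Qed.

Lemma rec_absz a f : recz a f -> rec a (fun e => `|f e|%N).
Proof.
move=> [p [q [rp rq fE]]].
have := rec_add _ _ _ (rec_sub _ _ _ rp rq) (rec_sub _ _ _ rq rp).
by congr rec; apply/funext => e; rewrite fE; lia.
Qed.

(** Adding [q * d] to the dividend [p - q] makes it nonnegative, which reduces Euclidean division of
integers to that of naturals. *)
Lemma recz_divz a f d : recz a f -> rec a d -> (forall e, 0 < d e)%N ->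
  recz a (fun e => (f e %/ (d e)%:Z)%Z).
Proof.
move=> [p [q [rp rq fE]]] rd d0.
exists (fun e => (p e + q e * (d e).-1) %/ d e)%N, q; split=> //.
  by apply: rec_div => //; apply: rec_add => //; apply: rec_mul => //; exact: rec_pred.
move=> e; rewrite -divz_nat.
have -> : (p e + q e * (d e).-1)%N%:Z = (q e)%:Z * (d e)%:Z + f e.
  by rewrite fE -(prednK (d0 e)) /= PoszD PoszM intS; ring.
rewrite divzMDl; last by rewrite eqz_nat -lt0n.
by rewrite addrC addKr.
Qed.

Lemma rec_bin a f g : rec a f -> rec a g -> rec a (fun e => 'C(f e, g e)).
Proof.
move=> rf rg; have rfact := rec_fact a.
have := rec_mul _ _ _ (rec_leq _ _ _ rg rf) (rec_div _ _ _ (rfact _ rf)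
  (rec_mul _ _ _ (rfact _ rg) (rfact _ (rec_sub _ _ _ rf rg)))).
congr rec; apply/funext => e; case: leqP => [gf|fg]; last by rewrite bin_small.
by rewrite mul1n -(bin_fact gf) mulnK // muln_gt0 !fact_gt0.
Qed.

Lemma recz_sign a f : rec a f -> recz a (fun e => (-1) ^+ f e).
Proof.
move=> rf; have := recz_add _ _ _ (recz_nat _ _ (rec_const a 1))
  (recz_opp _ _ (recz_nat _ _ (rec_mul _ _ _ (rec_const a 2) (rec_odd _ _ rf)))).
by congr recz; apply/funext => e; rewrite -signr_odd; case: (odd _).
Qed.

(** A variable exponent is not compatible with formal differences, hence the passage through the
sign and the absolute value. *)
Lemma recz_expn a f n : recz a f -> rec a n -> recz a (fun e => f e ^+ n e).
Proof.
move=> rf rn.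
have rneg := rec_neg _ _ (rec_lez _ _ _ (recz_nat _ _ (rec_zero a)) rf).
have := recz_mul _ _ _ (recz_sign _ _ (rec_mul _ _ _ rneg rn))
  (recz_nat _ _ (rec_exp _ _ _ (rec_absz _ _ rf) rn)).
congr recz; apply/funext => e; rewrite [f e in RHS]intEsign exprMn -exprM -ltNge.
congr (_ * _); elim: (n e) => // k IH; by rewrite expnS exprS PoszM IH.
Qed.

(** * The fourth moment averaged over all signs *)

Definition sgb {R : pzRingType} (b : bool) : R := if b then 1 else -1.

(** With [w_n = u_n + i v_n], this and [sq_im] are the real and imaginary parts of the coefficients
of the square of the trigonometric sum with coefficients [w_n]. *)
Definition sq_re {R : pzRingType} (u v : nat -> R) (k : nat) : R :=
  \sum_(n < k.+1) (u n * u (k - n)%N - v n * v (k - n)%N).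

Definition sq_im {R : pzRingType} (u v : nat -> R) (k : nat) : R :=
  \sum_(n < k.+1) (u n * v (k - n)%N + v n * u (k - n)%N).

(** The energy of the squared sum, hence the mean of the fourth power of its modulus on the circle.
The bound [2 * N] covers all frequencies when the coefficients vanish from [N] on. *)
Definition quartic {R : pzRingType} (u v : nat -> R) (N : nat) : R :=
  \sum_(k < 2 * N) (sq_re u v k ^+ 2 + sq_im u v k ^+ 2).

Definition energy {R : pzRingType} (u v : nat -> R) (N : nat) : R :=
  \sum_(n < N) (u n ^+ 2 + v n ^+ 2).

Lemma sum_antidiagonals (R : pzRingType) (N : nat) (F : nat -> nat -> R) :
  (forall n m, (N <= n)%N || (N <= m)%N -> F n m = 0) ->
  \sum_(k < 2 * N) \sum_(n < k.+1) F n (k - n)%N =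
  \sum_(n < N) \sum_(m < N) F n m.
Proof.
move=> F0.
transitivity (\sum_(k < 2 * N) \sum_(n < N | (n <= k)%N) F n (k - n)%N).
  apply: eq_bigr => k _.
  rewrite (big_ord_widen_cond (k.+1 + N)%N xpredT (fun n => F n (k - n)%N) (leq_addr _ _)).
  rewrite (big_ord_widen_cond (k.+1 + N)%N (fun n : nat => n <= k)%N
    (fun n => F n (k - n)%N) (leq_addl _ _)).
  rewrite big_mkcond [RHS]big_mkcond; apply: eq_bigr => n _ /=; rewrite ltnS.
  by case: (leqP n k) => //= _; case: (ltnP n N) => // Nn; rewrite F0 ?Nn.
rewrite (exchange_big_dep xpredT) //=; apply: eq_bigr => n _.
have E : (n + (2 * N - n) = 2 * N)%N by have := ltn_ord n; lia.
rewrite -(big_mkord (fun k => n <= k)%N (fun k => F n (k - n)%N)).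
rewrite (big_cat_nat (n := n)) //=; last by have := ltn_ord n; lia.
rewrite big_nat_cond big_pred0 ?add0r; last by move=> k; lia.
rewrite -{1}[n : nat]add0n big_addn (eq_bigl xpredT); last by move=> k; rewrite leq_addl.
rewrite big_mkord (big_ord_widen (2 * N - n) (fun m => F n m)); last first.
  by have := ltn_ord n; lia.
rewrite [RHS]big_mkcond; apply: eq_bigr => m _; rewrite addnK.
by case: ltnP => // Nm; rewrite F0 ?Nm ?orbT.
Qed.

Section SignMean.
Variables (R : realDomainType) (N : nat).
Implicit Type t : N.-tuple bool.

Let eps t n : R := sgb (nth false t n).

Let flip n t : N.-tuple bool := [tuple nth false t i (+) (i == n :> nat) | i < N].

Lemma flipK n : involutive (flip n).
Proof.
move=> t; apply: eq_from_tnth => i; rewrite tnth_mktuple.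
by rewrite nth_mktuple addbK (tnth_nth false).
Qed.

Lemma eps_flip n t m : (n < N)%N -> eps (flip n t) m = (-1) ^+ (m == n) * eps t m.
Proof.
move=> nN; rewrite /eps /flip; case: (ltnP m N) => mN.
  rewrite (nth_mktuple _ _ (Ordinal mN)) /=.
  by case: (nth _ _ _); case: eqP => _; rewrite /sgb /= ?mulr1 ?mul1r ?mulrN1 ?mulN1r ?opprK.
rewrite !nth_default ?size_tuple //.
have mn : (m == n) = false by lia.
by rewrite mn expr0 mul1r.
Qed.

Lemma eps2 t n : eps t n * eps t n = 1.
Proof. by rewrite /eps /sgb; case: nth; rewrite ?mulr1 ?mulrNN ?mulr1. Qed.

Lemma sum_flip n (F : N.-tuple bool -> R) :
  (forall t, F (flip n t) = - F t) -> \sum_t F t = 0.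
Proof.
move=> HF; apply/eqP; rewrite -[_ == _](mulrn_eq0 _ 2) /=.
rewrite mulr2n {1}(reindex_inj (inv_inj (flipK n))) /= -big_split /= big1 // => t _.
by rewrite HF addNr.
Qed.

(** If [n + m = p + q], a pair [{n, m}] different from [{p, q}] leaves some sign an odd number of
times in the product; flipping that sign shows that the sum vanishes. *)
Lemma mean_sign4 n m p q : (n < N)%N -> (m < N)%N -> (p < N)%N -> (q < N)%N ->
  (n + m = p + q)%N ->
  \sum_t eps t n * eps t m * (eps t p * eps t q) =
   ((p == n) || (p == m))%:R * (2 ^ N)%:R.
Proof.
move=> nN mN pN qN E.
have [/orP H|/norP[pn pm]] := boolP (_ || _); rewrite ?mul0r.
  rewrite mul1r (eq_bigr (fun=> 1)).
    by rewrite sumr_const card_tuple card_bool.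
  move=> t _; suff -> : eps t p * eps t q = eps t n * eps t m.
    by rewrite mulrACA !eps2 mulr1.
  case: H => /eqP ?; subst p.
    by have -> : q = m by lia.
  have -> : q = n by lia.
  by rewrite mulrC.
have [nm|nm] := eqVneq n m.
  subst m; apply: (sum_flip p) => t; rewrite !eps_flip // eqxx.
  have /negbTE -> : n != p by rewrite eq_sym.
  move/eqP in pn; have -> : (q == p) = false by lia.
  by rewrite !expr0 !mul1r expr1 !mulN1r mulNr mulrN.
apply: (sum_flip n) => t; rewrite !eps_flip // eqxx.
have /negbTE -> : m != n by rewrite eq_sym.
rewrite (negbTE pn); move/eqP in pm; have -> : (q == n) = false by lia.
by rewrite !expr0 !mul1r expr1 !mulN1r !mulNr.
Qed.

(** In the expanded square only the terms with [p = n] or [p = k - n] survive averaging, and each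
contributes [a n ^+ 2] to the mean by symmetry of [a]; at most two occur for each [n]. *)
Lemma mean_sq_conv (k : nat) (a : nat -> R) :
  (forall n, (n <= k)%N -> a (k - n)%N = a n) ->
  (forall n, (n <= k)%N -> (N <= n)%N || (N <= k - n)%N -> a n = 0) ->
  \sum_t (\sum_(n < k.+1) eps t n * eps t (k - n)%N * a n) ^+ 2 <=
  (2 ^ N)%:R * 2 * \sum_(n < k.+1) a n ^+ 2.
Proof.
move=> asym a0.
rewrite (eq_bigr (fun t => \sum_(n < k.+1) \sum_(p < k.+1)
  a n * a p * (eps t n * eps t (k - n)%N * (eps t p * eps t (k - p)%N)))); last first.
  move=> t _; rewrite expr2 big_distrlr; apply: eq_bigr => n _; apply: eq_bigr => p _ /=.
  by ring.
rewrite exchange_big /= mulr_sumr; apply: ler_sum => n _.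
rewrite exchange_big /=.
rewrite [leRHS](_ : _ = \sum_(p < k.+1) a n ^+ 2 * (2 ^ N)%:R *
    ((p == n)%:R + (p == (k - n)%N :> nat)%:R)); last first.
  rewrite -mulr_sumr big_split /=.
  rewrite (bigD1 n) //= eqxx big1 ?addr0 => [|i /negbTE ->] //.
  have kn : (k - n < k.+1)%N by lia.
  rewrite (bigD1 (Ordinal kn)) //= eqxx big1 ?addr0.
    by rewrite mulr1n; move: (_ ^ N)%:R => X; ring.
  by move=> i /negbTE; rewrite -val_eqE /= => ->.
apply: ler_sum => p _; rewrite -mulr_sumr.
have nk := ltn_ord n; have pk := ltn_ord p; rewrite !ltnS in nk pk.
have pos (x : R) : 0 <= x ^+ 2 * (2 ^ N)%:R * ((p == n)%:R + (p == (k - n)%N :> nat)%:R).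
  apply: mulr_ge0; first by apply: mulr_ge0; [exact: sqr_ge0|exact: ler0n].
  by apply: addr_ge0; exact: ler0n.
have [H|H] := boolP ((N <= n)%N || (N <= k - n)%N).
  by rewrite (a0 n) // expr2 !mul0r lexx.
have [H'|H'] := boolP ((N <= p)%N || (N <= k - p)%N).
  by rewrite (a0 p) // mulr0 mul0r; exact: pos.
rewrite mean_sign4; try lia.
have [pn|pn] := eqVneq p n.
  rewrite pn eqxx /= mul1r -expr2; apply: ler_peMr; last by rewrite lerDl ler0n.
  by apply: mulr_ge0; [exact: sqr_ge0|exact: ler0n].
rewrite -val_eqE in pn; rewrite (negbTE pn) /=; case: eqP => [E|_].
  by rewrite E asym // mul1r add0r mulr1 expr2.
by rewrite !mulr0n addr0 mul0r !mulr0 lexx.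
Qed.

(** For fixed frequency [k], the terms [w_n w_(k-n)] are symmetric in [n] and [k - n], so each
coefficient of the square has mean square modulus at most twice the sum of
[|w_n|^2 |w_(k-n)|^2]; summing over [k] gives the square of the energy. *)
Lemma mean_quartic (u v : nat -> R) :
  (forall n, (N <= n)%N -> u n = 0) -> (forall n, (N <= n)%N -> v n = 0) ->
  \sum_t quartic (fun n => eps t n * u n) (fun n => eps t n * v n) N <=
  (2 ^ N)%:R * 2 * energy u v N ^+ 2.
Proof.
move=> u0 v0; rewrite exchange_big /=.
pose q n := u n ^+ 2 + v n ^+ 2.
have -> : energy u v N ^+ 2 = \sum_(k < 2 * N) \sum_(n < k.+1) q n * q (k - n)%N.
  rewrite (sum_antidiagonals _ N (fun n m => q n * q m)) /q; last first.
    by move=> n m /orP[] H; rewrite (u0 _ H) (v0 _ H) !expr2 ?mulr0 ?mul0r ?addr0 ?mulr0 ?mul0r.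
  by rewrite /energy expr2 big_distrlr.
rewrite mulr_sumr; apply: ler_sum => k _; rewrite big_split /=.
pose a n := u n * u (k - n)%N - v n * v (k - n)%N.
pose b n := u n * v (k - n)%N + v n * u (k - n)%N.
rewrite (eq_bigr (fun n : 'I_k.+1 => a n ^+ 2 + b n ^+ 2)); last first.
  by move=> n _; rewrite /q /a /b; ring.
rewrite big_split /= mulrDr; apply: lerD.
  rewrite (eq_bigr (fun t => (\sum_(n < k.+1) eps t n * eps t (k - n)%N * a n) ^+ 2)).
    apply: mean_sq_conv => [n nk|n nk /orP[] H]; rewrite /a.
    - by rewrite subKn //; ring.
    - by rewrite (u0 _ H) (v0 _ H); ring.
    - by rewrite (u0 _ H) (v0 _ H); ring.
  move=> t _; congr (_ ^+ 2); apply: eq_bigr => n _; rewrite /a; ring.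
rewrite (eq_bigr (fun t => (\sum_(n < k.+1) eps t n * eps t (k - n)%N * b n) ^+ 2)).
  apply: mean_sq_conv => [n nk|n nk /orP[] H]; rewrite /b.
  - by rewrite subKn //; ring.
  - by rewrite (u0 _ H) (v0 _ H); ring.
  - by rewrite (u0 _ H) (v0 _ H); ring.
move=> t _; congr (_ ^+ 2); apply: eq_bigr => n _; rewrite /b; ring.
Qed.
End SignMean.

(** * Trigonometric sums on the circle *)

Definition trig_re {R : realType} (U V : nat -> R) (N : nat) (t : R) : R :=
  \sum_(n < N) (U n * cos (2 * pi * n%:R * t) - V n * sin (2 * pi * n%:R * t)).

Definition trig_im {R : realType} (U V : nat -> R) (N : nat) (t : R) : R :=
  \sum_(n < N) (U n * sin (2 * pi * n%:R * t) + V n * cos (2 * pi * n%:R * t)).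

Section Circle.
Variable R : realType.
Local Notation mu := (@lebesgue_measure R).
Local Notation I f := (\int[mu]_(t in `[0, 1]) f t).
Implicit Types f g : R -> R.

Lemma sumf_continuous (J : Type) (r : seq J) (F : J -> R -> R) :
  (forall j, continuous (F j)) -> continuous (fun t => \sum_(j <- r) F j t).
Proof.
move=> cF; elim: r => [|j r IH] t.
  under eq_fun do rewrite big_nil; exact: cvg_cst.
under eq_fun do rewrite big_cons; apply: cvgD; [exact: cF|exact: IH].
Qed.

Lemma continuous_cosZ (a : R) : continuous (fun t => cos (a * t)).
Proof.
move=> t; apply: (@continuous_comp _ _ _ (fun t => a * t)); last exact: continuous_cos.
exact: mulrl_continuous.
Qed.

Lemma continuous_sinZ (a : R) : continuous (fun t => sin (a * t)).
Proof.
move=> t; apply: (@continuous_comp _ _ _ (fun t => a * t)); last exact: continuous_sin.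
exact: mulrl_continuous.
Qed.

Lemma cstMf_continuous (a : R) f : continuous f -> continuous (fun t => a * f t).
Proof. by move=> cf t; apply: cvgM; [exact: cvg_cst|exact: cf]. Qed.

Lemma addf_continuous f g : continuous f -> continuous g -> continuous (fun t => f t + g t).
Proof. by move=> cf cg t; apply: cvgD; [exact: cf|exact: cg]. Qed.

Lemma subf_continuous f g : continuous f -> continuous g -> continuous (fun t => f t - g t).
Proof. by move=> cf cg t; apply: cvgB; [exact: cf|exact: cg]. Qed.

Lemma expf_continuous f n : continuous f -> continuous (fun t => f t ^+ n).
Proof.
move=> cf; elim: n => [|n IH] t; first exact: cvg_cst.
under eq_fun do rewrite exprS.
by apply: cvgM; [exact: cf|exact: IH].
Qed.

Lemma normf_continuous f : continuous f -> continuous (fun t => `|f t|).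
Proof. by move=> cf t; apply: cvg_norm; exact: cf. Qed.

Lemma integrable01_continuous f : continuous f -> mu.-integrable `[0, 1] (EFin \o f).
Proof.
move=> cf; apply: continuous_compact_integrable; first exact: segment_compact.
exact: continuous_subspaceT.
Qed.

Lemma Rint01D f g : continuous f -> continuous g -> I (fun t => f t + g t) = I f + I g.
Proof. by move=> cf cg; rewrite RintegralD //; exact: integrable01_continuous. Qed.

Lemma Rint01B f g : continuous f -> continuous g -> I (fun t => f t - g t) = I f - I g.
Proof. by move=> cf cg; rewrite RintegralB //; exact: integrable01_continuous. Qed.

Lemma Rint01Z a f : continuous f -> I (fun t => a * f t) = a * I f.
Proof. by move=> cf; rewrite RintegralZl //; exact: integrable01_continuous. Qed.

Lemma Rint01_cst a : I (fun=> a) = a.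
Proof.
rewrite Rintegral_cst //= lebesgue_measure_itv /= lte_fin ltr01 /=.
by rewrite oppr0 addr0 mulr1.
Qed.

Lemma le_Rint01 f g : continuous f -> continuous g -> (forall t, f t <= g t) -> I f <= I g.
Proof.
by move=> cf cg fg; apply: le_Rintegral => //; exact: integrable01_continuous.
Qed.

Lemma Rint01_sum (J : Type) (r : seq J) (F : J -> R -> R) :
  (forall j, continuous (F j)) ->
  I (fun t => \sum_(j <- r) F j t) = \sum_(j <- r) I (F j).
Proof.
move=> cF; elim: r => [|j r IH].
  by rewrite big_nil; under eq_Rintegral do rewrite big_nil; rewrite Rint01_cst.
rewrite big_cons -IH -Rint01D //; last exact: sumf_continuous.
by apply: eq_Rintegral => t _; rewrite big_cons.
Qed.

Lemma Rint01_derive (F f : R -> R) : (forall t : R, is_derive t (1 : R) F (f t)) ->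
  continuous f -> I f = F 1 - F 0.
Proof.
move=> dF cf; rewrite /Rintegral (@continuous_FTC2 _ f F 0 1) //.
- exact: continuous_subspaceT.
- split.
  + by move=> t _; case: (dF t).
  + apply: cvg_at_right_filter; apply: differentiable_continuous.
    by apply/derivable1_diffP; case: (dF 0).
  + apply: cvg_at_left_filter; apply: differentiable_continuous.
    by apply/derivable1_diffP; case: (dF 1).
- by move=> t _; rewrite derive1E; case: (dF t).
Qed.

Lemma Rint01_cos (a : R) : a != 0 -> sin a = 0 -> I (fun t => cos (a * t)) = 0.
Proof.
move=> a0 sa.
have dF (t : R) : is_derive t (1 : R) (fun t => a^-1 * sin (a * t)) (cos (a * t)).
  by apply: is_derive_eq; rewrite /GRing.scale /=; field.
by rewrite (Rint01_derive _ _ dF (continuous_cosZ a)) mulr0 mulr1 sin0 sa subrr.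
Qed.

Lemma Rint01_sin (a : R) : a != 0 -> cos a = 1 -> I (fun t => sin (a * t)) = 0.
Proof.
move=> a0 ca.
have dF (t : R) : is_derive t (1 : R) (fun t => - a^-1 * cos (a * t)) (sin (a * t)).
  by apply: is_derive_eq; rewrite /GRing.scale /=; field.
by rewrite (Rint01_derive _ _ dF (continuous_sinZ a)) mulr0 mulr1 cos0 ca subrr.
Qed.

Lemma cossin_2pi_nat (n : nat) : cos (2 * pi * n%:R) = 1 :> R /\ sin (2 * pi * n%:R) = 0 :> R.
Proof.
elim: n => [|n [IHc IHs]]; first by rewrite mulr0 cos0 sin0.
have -> : 2 * pi * n.+1%:R = 2 * pi * n%:R + pi *+ 2 :> R by rewrite -addn1 natrD; ring.
by rewrite cosD2pi sinD2pi.
Qed.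

(** Orthogonality of the exponentials, in the form produced by expanding a squared modulus. *)
Lemma Rint01_harmonic (A B : R) (k l : nat) :
  I (fun t => A * cos (2 * pi * (k%:R - l%:R) * t) +
              B * sin (2 * pi * (k%:R - l%:R) * t)) = A * (k == l)%:R.
Proof.
rewrite Rint01D; [|apply: cstMf_continuous; exact: continuous_cosZ|
  apply: cstMf_continuous; exact: continuous_sinZ].
rewrite !Rint01Z; [|exact: continuous_sinZ|exact: continuous_cosZ].
have [->|kl] := eqVneq k l.
  rewrite subrr mulr0; under eq_Rintegral do rewrite mul0r cos0.
  under [X in _ + B * X]eq_Rintegral do rewrite mul0r sin0.
  by rewrite !Rint01_cst mulr0 addr0.
have [ck sk] := cossin_2pi_nat k; have [cl sl] := cossin_2pi_nat l.
have E : 2 * pi * (k%:R - l%:R) != 0 :> R.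
  apply: mulf_neq0; last by rewrite subr_eq0 eqr_nat.
  by rewrite gt_eqF // mulr_gt0 ?pi_gt0.
rewrite Rint01_cos ?Rint01_sin ?mulr0 ?addr0 //.
- by rewrite mulrBr cosB ck cl sk sl mulr1 mulr0 addr0.
- by rewrite mulrBr sinB ck cl sk sl mulr0 mul0r subr0.
Qed.

Variables (U V : nat -> R).

Lemma continuous_trig_re N : continuous (trig_re U V N).
Proof.
apply: sumf_continuous => n; apply: subf_continuous; apply: cstMf_continuous.
- exact: continuous_cosZ.
- exact: continuous_sinZ.
Qed.

Lemma continuous_trig_im N : continuous (trig_im U V N).
Proof.
apply: sumf_continuous => n; apply: addf_continuous; apply: cstMf_continuous.
- exact: continuous_sinZ.
- exact: continuous_cosZ.
Qed.

(** The squared modulus expands into harmonics of frequencies [k - l], of which only [k = l]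
survives integration. *)
Lemma parseval N :
  I (fun t => trig_re U V N t ^+ 2 + trig_im U V N t ^+ 2) = energy U V N.
Proof.
pose F (k l : nat) t := (U k * U l + V k * V l) * cos (2 * pi * (k%:R - l%:R) * t) +
  (U k * V l - V k * U l) * sin (2 * pi * (k%:R - l%:R) * t).
have cF k l : continuous (F k l).
  apply: addf_continuous; apply: cstMf_continuous; first exact: continuous_cosZ.
  exact: continuous_sinZ.
transitivity (I (fun t => \sum_(k < N) \sum_(l < N) F k l t)).
  apply: eq_Rintegral => t _; rewrite !expr2 /trig_re /trig_im !big_distrlr -big_split /=.
  apply: eq_bigr => k _; rewrite -big_split; apply: eq_bigr => l _ /=.
  rewrite /F.
  have -> : 2 * pi * (k%:R - l%:R) * t = 2 * pi * k%:R * t - 2 * pi * l%:R * t by ring.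
  by rewrite cosB sinB; ring.
rewrite Rint01_sum => [|k]; last exact: sumf_continuous.
apply: eq_bigr => k _; rewrite Rint01_sum //.
rewrite (eq_bigr (fun l : 'I_N => (U k * U l + V k * V l) * (k == l)%:R)).
  rewrite (bigD1 k) //= eqxx mulr1 !expr2 big1 ?addr0 // => l.
  by rewrite eq_sym => /negbTE ->; rewrite mulr0.
by move=> l _; rewrite Rint01_harmonic.
Qed.

Lemma Rint01_trig_re N : (0 < N)%N -> I (trig_re U V N) = U 0%N.
Proof.
case: N => // N _; pose F (n : nat) t := U n * cos (2 * pi * (n%:R - 0%:R) * t) +
  - V n * sin (2 * pi * (n%:R - 0%:R) * t).
transitivity (I (fun t => \sum_(n < N.+1) F n t)).
  apply: eq_Rintegral => t _; apply: eq_bigr => n _; rewrite /F subr0; ring.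
rewrite Rint01_sum; last first.
  move=> n; apply: addf_continuous; apply: cstMf_continuous.
    exact: continuous_cosZ.
  exact: continuous_sinZ.
rewrite big_ord_recl big1 ?addr0 => [|n _]; rewrite Rint01_harmonic /= ?mulr1 //.
by rewrite mulr0.
Qed.

End Circle.

Section Square.
Variables (R : realType) (U V : nat -> R) (N : nat).
Hypotheses (U0 : forall n, (N <= n)%N -> U n = 0) (V0 : forall n, (N <= n)%N -> V n = 0).
Local Notation mu := (@lebesgue_measure R).
Local Notation I f := (\int[mu]_(t in `[0, 1]) f t).

(** The real part of [(re + i im) ^ 2]; its coefficients are collected along antidiagonals. *)
Lemma trig_sq_re t :
  trig_re (sq_re U V) (sq_im U V) (2 * N) t = trig_re U V N t ^+ 2 - trig_im U V N t ^+ 2.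
Proof.
pose F n m := (U n * U m - V n * V m) * cos (2 * pi * (n + m)%:R * t) -
   (U n * V m + V n * U m) * sin (2 * pi * (n + m)%:R * t).
transitivity (\sum_(k < 2 * N) \sum_(n < k.+1) F n (k - n)%N).
  apply: eq_bigr => k _; rewrite !mulr_suml -sumrB; apply: eq_bigr => n _.
  by rewrite /F subnKC // -ltnS.
rewrite sum_antidiagonals => [|n m /orP[] H]; last 2 first.
- by rewrite /F (U0 _ H) (V0 _ H); ring.
- by rewrite /F (U0 _ H) (V0 _ H); ring.
rewrite !expr2 /trig_re /trig_im !big_distrlr -sumrB /=.
apply: eq_bigr => n _; rewrite -sumrB; apply: eq_bigr => m _.
by rewrite /F natrD mulrDr mulrDl cosD sinD; ring.
Qed.

Lemma trig_sq_im t :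
  trig_im (sq_re U V) (sq_im U V) (2 * N) t = 2 * trig_re U V N t * trig_im U V N t.
Proof.
pose F n m := (U n * U m - V n * V m) * sin (2 * pi * (n + m)%:R * t) +
   (U n * V m + V n * U m) * cos (2 * pi * (n + m)%:R * t).
transitivity (\sum_(k < 2 * N) \sum_(n < k.+1) F n (k - n)%N).
  apply: eq_bigr => k _; rewrite !mulr_suml -big_split; apply: eq_bigr => n _.
  by rewrite /F subnKC // -ltnS.
rewrite sum_antidiagonals => [|n m /orP[] H]; last 2 first.
- by rewrite /F (U0 _ H) (V0 _ H); ring.
- by rewrite /F (U0 _ H) (V0 _ H); ring.
have -> : 2 * trig_re U V N t * trig_im U V N t =
   trig_re U V N t * trig_im U V N t + trig_im U V N t * trig_re U V N t by ring.
rewrite /trig_re /trig_im !big_distrlr -big_split /=.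
apply: eq_bigr => n _; rewrite -big_split; apply: eq_bigr => m _.
by rewrite /F natrD mulrDr mulrDl cosD sinD /=; ring.
Qed.

(** The real part squared is half of the squared modulus plus half of the real part of the square,
whose mean is its constant coefficient. *)
Lemma Rint01_trig_re2 : (0 < N)%N ->
  I (fun t => trig_re U V N t ^+ 2) = (energy U V N + U 0%N ^+ 2 - V 0%N ^+ 2) / 2.
Proof.
move=> N0.
have c2 (f : R -> R) : continuous f -> continuous (fun t => f t ^+ 2).
  exact: expf_continuous.
have cre := c2 _ (continuous_trig_re _ U V N).
have cim := c2 _ (continuous_trig_im _ U V N).
have := parseval _ U V N; rewrite Rint01D // => P.
have := Rint01_trig_re _ (sq_re U V) (sq_im U V) (2 * N).
rewrite muln_gt0 N0 => /(_ isT).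
under eq_Rintegral do rewrite trig_sq_re.
rewrite Rint01B // /sq_re big_ord1 subnn -!expr2 => Q.
by rewrite -P -addrA -Q; field.
Qed.

(** The fourth power of the real part is bounded by the fourth power of the modulus, which is the
squared modulus of the square. *)
Lemma Rint01_trig_re4 : I (fun t => trig_re U V N t ^+ 4) <= quartic U V N.
Proof.
rewrite [leRHS](_ : _ = energy (sq_re U V) (sq_im U V) (2 * N)) // -parseval.
apply: le_Rint01 => [||t].
- by apply: expf_continuous; exact: continuous_trig_re.
- apply: addf_continuous; apply: expf_continuous; first exact: continuous_trig_re.
  exact: continuous_trig_im.
rewrite trig_sq_re trig_sq_im.
set a := trig_re _ _ _ _; set b := trig_im _ _ _ _; rewrite -subr_ge0.
have -> : (a ^+ 2 - b ^+ 2) ^+ 2 + (2 * a * b) ^+ 2 - a ^+ 4 =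
  b ^+ 2 * (2 * a ^+ 2 + b ^+ 2) by ring.
apply: mulr_ge0; first exact: sqr_ge0.
by apply: addr_ge0; [apply: mulr_ge0; [exact: ler0n|exact: sqr_ge0]|exact: sqr_ge0].
Qed.

(** Integration of [y ^ 2 <= l |y| + y ^ 4 / l ^ 2]: the first term suffices where [|y| <= l], the
second one elsewhere.  Leaving [l] free avoids square roots. *)
Lemma energy_le_L1 (l : R) : (0 < N)%N -> 0 < l ->
  (energy U V N + U 0%N ^+ 2 - V 0%N ^+ 2) / 2 <=
    l * I (fun t => `|trig_re U V N t|) + quartic U V N / l ^+ 2.
Proof.
move=> N0 l0; rewrite -Rint01_trig_re2 //.
have cre := continuous_trig_re _ U V N.
have cabs : continuous (fun t => `|trig_re U V N t|) by exact: normf_continuous.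
have c4 : continuous (fun t => trig_re U V N t ^+ 4) by exact: expf_continuous.
apply: (@le_trans _ _ (I (fun t => l * `|trig_re U V N t| + l ^- 2 * trig_re U V N t ^+ 4))).
  apply: le_Rint01 => [||t]; first exact: expf_continuous.
    by apply: addf_continuous; exact: cstMf_continuous.
  set y := trig_re _ _ _ _; have y2 : y ^+ 2 = `|y| * `|y| by rewrite -expr2 real_normK ?num_real.
  have [yl|ly] := lerP `|y| l.
    rewrite y2; apply: (@le_trans _ _ (l * `|y|)); first exact: ler_wpM2r.
    by rewrite lerDl mulr_ge0 ?invr_ge0 ?exprn_even_ge0 // exprn_ge0 // ltW.
  apply: (@le_trans _ _ (l ^- 2 * y ^+ 4)); last by rewrite lerDr mulr_ge0 // ltW.
  rewrite mulrC ler_pdivlMr ?exprn_gt0 // -[4%N]/(2 + 2)%N exprD.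
  apply: ler_wpM2l; first exact: sqr_ge0.
  by rewrite y2 -expr2; apply: lerXn2r; rewrite ?nnegrE ?(ltW l0) ?normr_ge0 // ltW.
rewrite Rint01D ?Rint01Z //; [|exact: cstMf_continuous..].
rewrite lerD2l mulrC; apply: ler_wpM2r; last exact: Rint01_trig_re4.
by rewrite invr_ge0 exprn_ge0 // ltW.
Qed.

End Square.

(** * Rational approximation of the phases *)

(** Real part of [i ^ j]; [im_i j] is its imaginary part. *)
Definition re_i {R : pzRingType} (j : nat) : R := if odd j then 0 else (-1) ^+ j./2.
Definition im_i {R : pzRingType} (j : nat) : R := if odd j then (-1) ^+ j./2 else 0.

(** With [c] one of [re_i] and [im_i], the real or imaginary part of [(D + i A) ^ k].  The closed
form makes it a finite sum of integers, and avoids a simultaneous recursion on two values. *)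
Definition gauss_pow {R : pzRingType} (c : nat -> R) (k : nat) (D A : R) : R :=
  \sum_(j < k.+1) 'C(k, j)%:R * D ^+ (k - j) * A ^+ j * c j.

Lemma expr_i (R : rcfType) j : ('i ^+ j = re_i j +i* im_i j :> R[i])%C.
Proof.
have H m : ('i ^+ m.*2 = ((-1) ^+ m)%:C :> R[i])%C.
  by rewrite -mul2n exprM sqr_i rmorphXn rmorphN1.
rewrite /re_i /im_i -{1}(odd_double_half j); case: (odd j); rewrite ?add1n ?add0n ?exprS H.
  by apply/eqP; rewrite eq_complex /=; apply/andP; split; apply/eqP; ring.
by [].
Qed.

Lemma gauss_powE (R : rcfType) k (D A : R) :
  (((D +i* A) ^+ k) = gauss_pow re_i k D A +i* gauss_pow im_i k D A)%C.
Proof.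
have -> : (D +i* A)%C = (D%:C + A%:C * 'i)%C.
  by apply/eqP; rewrite eq_complex /=; apply/andP; split; apply/eqP; ring.
rewrite exprDn /gauss_pow.
have pairE (a b : R) : (a +i* b = a%:C + 'i * b%:C)%C.
  by apply/eqP; rewrite eq_complex /=; apply/andP; split; apply/eqP; ring.
rewrite pairE !rmorph_sum mulr_sumr -big_split /=; apply: eq_bigr => j _.
rewrite exprMn expr_i pairE !rmorphM !rmorphXn rmorph_nat -mulr_natl.
ring.
Qed.

Lemma de_moivre (R : realType) k (r x : R) :
  (((r * cos x) +i* (r * sin x)) ^+ k =
    (r ^+ k * cos (k%:R * x)) +i* (r ^+ k * sin (k%:R * x)))%C.
Proof.
elim: k => [|k IH]; first by rewrite mul0r cos0 sin0 !expr0 mulr1 mulr0.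
have -> : k.+1%:R * x = x + k%:R * x by rewrite -addn1 natrD; ring.
rewrite exprS IH cosD sinD exprS; apply/eqP; rewrite eq_complex /=.
by apply/andP; split; apply/eqP; ring.
Qed.

(** The argument of [D + i A] is [atan (A / D)] and its squared modulus is a polynomial in [D] and
[A]; the even exponent avoids the square root in the modulus of the power. *)
Lemma gauss_pow_atan (R : realType) (M : nat) (D A : R) : 0 < D ->
  gauss_pow re_i (2 * M) D A / (D ^+ 2 + A ^+ 2) ^+ M = cos ((2 * M)%:R * atan (A / D)) /\
  gauss_pow im_i (2 * M) D A / (D ^+ 2 + A ^+ 2) ^+ M = sin ((2 * M)%:R * atan (A / D)).
Proof.
move=> D0; set y := atan _.
have c0 : cos y != 0.
  rewrite cos_atan invr_neq0 // gt_eqF // sqrtr_gt0.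
  by have := sqr_ge0 (A / D); lra.
have DE : D = D / cos y * cos y by rewrite mulfVK.
have AE : A = D / cos y * sin y.
  by rewrite mulrAC -mulrA -/(tan y) atanK mulrC mulfVK // gt_eqF.
have DA : D ^+ 2 + A ^+ 2 = (D / cos y) ^+ 2.
  rewrite {1}DE {1}AE !exprMn -mulrDr cos2Dsin2; ring.
have r0 : (D / cos y) ^+ (2 * M) != 0 by rewrite expf_neq0 // mulf_neq0 ?invr_neq0 // gt_eqF.
have := gauss_powE _ (2 * M) D A; rewrite {1}DE {1}AE de_moivre => -[<- <-].
by rewrite DA -exprM; split; rewrite mulrAC mulfV ?mul1r.
Qed.

Lemma cos_lip (R : realType) (a b : R) : `|cos a - cos b| <= `|a - b|.
Proof.
wlog ab : a b / b <= a => [H|].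
  by have [/H //|/ltW/H] := leP b a; rewrite distrC [leRHS]distrC.
have [c _ ->] := @MVT_segment R cos (fun x => - sin x) b a ab
  (fun x _ => is_derive_cos x) (continuous_subspaceT (@continuous_cos R)).
by rewrite normrM normrN ler_piMl // sin_max.
Qed.

Lemma sin_lip (R : realType) (a b : R) : `|sin a - sin b| <= `|a - b|.
Proof.
rewrite -!cosBpihalf; apply: le_trans (cos_lip _ _ _) _.
by rewrite opprB addrA subrK.
Qed.

(** By the mean value theorem, as the derivative of [atan x - x] is at most [|x|] in modulus. *)
Lemma atan_sub_le (R : realType) (h : R) : `|atan h - h| <= h ^+ 2.
Proof.
pose f x : R := atan x - x.
have df x : is_derive x (1 : R) f ((1 + x ^+ 2)^-1 - 1).
  by apply: is_deriveB; exact: is_derive1_atan.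
have cf : continuous f.
  by move=> x; apply: differentiable_continuous; apply/derivable1_diffP; case: (df x).
have key (c : R) : `|(1 + c ^+ 2)^-1 - 1| <= `|c|.
  have c2 : 0 < 1 + c ^+ 2 by have := sqr_ge0 c; lra.
  have -> : (1 + c ^+ 2)^-1 - 1 = - (c ^+ 2 / (1 + c ^+ 2)) by field; rewrite gt_eqF.
  have q0 : 0 <= c ^+ 2 / (1 + c ^+ 2) by apply: divr_ge0; [exact: sqr_ge0|exact: ltW].
  rewrite normrN ger0_norm // ler_pdivrMr //.
  have := sqr_ge0 (`|c| - 1); have := normr_ge0 c; rewrite -(real_normK (num_real c)).
  move: `|c| => z; nra.
have f0 : f 0 = 0 by rewrite /f atan0 subr0.
have [h0|/ltW h0] := leP 0 h.
  have [c /[!in_itv]/= /andP[c0 ch]] := MVT_segment h0 (fun x _ => df x) (continuous_subspaceT cf).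
  rewrite f0 !subr0 -/(f h) => ->; rewrite normrM expr2 (ger0_norm h0).
  by apply: ler_wpM2r => //; apply: le_trans (key c) _; rewrite ger0_norm.
have [c /[!in_itv]/= /andP[c0 ch]] := MVT_segment h0 (fun x _ => df x) (continuous_subspaceT cf).
rewrite f0 !sub0r -/(f h) => E.
have -> : f h = ((1 + c ^+ 2)^-1 - 1) * h by rewrite -[LHS]opprK E mulrN opprK.
rewrite normrM -[h ^+ 2]sqrrN expr2 (ler0_norm h0).
apply: ler_wpM2r; first by rewrite oppr_ge0.
by apply: le_trans (key c) _; rewrite ler0_norm // lerN2.
Qed.

Lemma angle_approx (R : realType) (M : nat) (t : R) : (0 < M)%N ->
  `|(2 * M)%:R * atan (t / (2 * M)%:R) - t| <= t ^+ 2 / (2 * M)%:R.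
Proof.
move=> M0; have M0' : 0 < (2 * M)%:R :> R by rewrite ltr0n muln_gt0.
move: (2 * M)%:R M0' => K K0.
rewrite [X in `|X|](_ : _ = K * (atan (t / K) - t / K)); last by field; rewrite gt_eqF.
rewrite normrM gtr0_norm //.
rewrite [leRHS](_ : _ = K * (t / K) ^+ 2); last by field; rewrite gt_eqF.
by rewrite ler_pM2l //; exact: atan_sub_le.
Qed.

(** * Rational approximation of the coefficients *)

Lemma recz_re_i a f : rec a f -> recz a (fun e => re_i (f e)).
Proof.
move=> rf; have := recz_mul _ _ _ (recz_nat _ _ (rec_neg _ _ (rec_odd _ _ rf)))
  (recz_sign _ _ (rec_div _ _ _ rf (rec_const _ 2))).
congr recz; apply/funext => e; rewrite /re_i divn2.
by case: (odd _); rewrite ?mul0r ?mul1r.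
Qed.

Lemma recz_im_i a f : rec a f -> recz a (fun e => im_i (f e)).
Proof.
move=> rf; have := recz_mul _ _ _ (recz_nat _ _ (rec_odd _ _ rf))
  (recz_sign _ _ (rec_div _ _ _ rf (rec_const _ 2))).
congr recz; apply/funext => e; rewrite /im_i divn2.
by case: (odd _); rewrite ?mul0r ?mul1r.
Qed.

Lemma recz_gauss_pow (c : nat -> int) (k : nat -> nat) (D A : nat -> int) :
  (forall a f, rec a f -> recz a (fun e => c (f e))) ->
  rec 1 (fun e => k (e 0%N)) -> recz 1 (fun e => D (e 0%N)) ->
  recz 1 (fun e => A (e 0%N)) ->
  recz 1 (fun e => gauss_pow c (k (e 0%N)) (D (e 0%N)) (A (e 0%N))).
Proof.
move=> rc rk rD rA.
apply: (recz_sum 1 (fun e => (k (e 0%N)).+1) (fun j e =>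
  'C(k (e 0%N), j)%:R * D (e 0%N) ^+ (k (e 0%N) - j) * A (e 0%N) ^+ j * c j)).
  exact: rec_succ.
have j2 := rec_arg 2 0.
have k2 : rec 2 (fun e => k (e 1%N)) by apply: (rec_call1 _ k) => //; exact: rec_arg.
apply: recz_mul; last exact: rc.
apply: recz_mul; last by apply: recz_expn => //; apply: (recz_call1 _ A) => //; exact: rec_arg.
apply: recz_mul.
  have := recz_nat _ _ (rec_bin _ _ _ k2 j2).
  by congr recz; apply/funext => e; rewrite natz.
apply: recz_expn; last exact: rec_sub.
by apply: (recz_call1 _ D) => //; exact: rec_arg.
Qed.

Lemma intr_gauss_pow (R : realType) (c : nat -> int) (c' : nat -> R) k (D A : int) :
  (forall j, (c j)%:~R = c' j) ->
  (gauss_pow c k D A)%:~R = gauss_pow c' k D%:~R A%:~R.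
Proof.
move=> cc'; rewrite rmorph_sum; apply: eq_bigr => j _.
by rewrite !rmorphM !rmorphXn /= cc' natz.
Qed.

Lemma intr_re_i (R : realType) j : (re_i j : int)%:~R = re_i j :> R.
Proof. by rewrite /re_i; case: odd; rewrite // rmorphXn rmorphN1. Qed.

Lemma intr_im_i (R : realType) j : (im_i j : int)%:~R = im_i j :> R.
Proof. by rewrite /im_i; case: odd; rewrite // rmorphXn rmorphN1. Qed.

Lemma floor_approx (R : realType) (z : int) (d : nat) : (0 < d)%N ->
  `|z%:~R / d%:R - (z %/ d)%Z%:~R| <= 1 :> R.
Proof.
move=> d0; have d0' : 0 < d%:R :> R by rewrite ltr0n.
have -> : z%:~R / d%:R - (z %/ d)%Z%:~R = (z %% d)%Z%:~R / d%:R :> R.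
  rewrite {1}(divz_eq z d) rmorphD rmorphM /= -[(Posz d)%:~R]/(d%:R); field.
  by rewrite gt_eqF.
have m0 : (0 <= z %% d)%Z by rewrite modz_ge0 // eqz_nat -lt0n.
have m1 : ((z %% d)%Z <= d :> int) by apply: ltW; rewrite ltz_pmod // ltz_nat.
rewrite ger0_norm ?ler_pdivrMr ?mul1r //; last by apply: divr_ge0; rewrite ?ler0z ?ler0n.
by rewrite -[d%:R]/((Posz d)%:~R) ler_int.
Qed.

(** Given [n], one computes a bound [X n] of [|x n|], then [phi n] with error [2 ^- (n + X n)] as
[A n / B n], and takes for the phase the argument of [(D n + i A n) ^ (2 M n)]; since
[X <= 2 ^ X], the error on the phase stays of order [2 ^- n] after multiplication by [x n].
Four errors of at most [2 ^- n] result: one from [x n], two from the phase and one from rounding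
to a multiple of [2 ^- n]. *)
Lemma computable_polar (R : realType) (x phi : nat -> R) :
  computable_sequence x -> computable_sequence phi ->
  exists P Q : nat -> int, [/\ recz 1 (fun e => P (e 0%N)), recz 1 (fun e => Q (e 0%N)),
    forall n, `|x n * cos (phi n) - (P n)%:~R / 2 ^+ n| <= 4 / 2 ^+ n &
    forall n, `|x n * sin (phi n) - (Q n)%:~R / 2 ^+ n| <= 4 / 2 ^+ n].
Proof.
move=> [s [a [b [cs ca cb b0 Hx]]]] [s' [a' [b' [cs' ca' cb' b0' Hphi]]]].
have r2 f : computable2 f -> rec 2 (fun e => f (e 0%N) (e 1%N)).
  by move=> [c Hc]; exists c => -[|m [|n []]].
move/r2 in cs; move/r2 in ca; move/r2 in cb; move/r2 in cs'; move/r2 in ca'; move/r2 in cb'.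
have r1 := rec_arg 1 0.
pose X n := (a n 0 %/ b n 0 + 2)%N.
have rX : rec 1 (fun e => X (e 0%N)).
  apply: rec_add (rec_const _ _); apply: rec_div.
    exact: rec_call2 ca r1 (rec_zero _).
  exact: rec_call2 cb r1 (rec_zero _).
pose k n := (n + X n)%N.
have rk : rec 1 (fun e => k (e 0%N)) by exact: rec_add.
pose A n : int := (-1) ^+ s' n (k n) * (a' n (k n))%:Z.
have rA : recz 1 (fun e => A (e 0%N)).
  apply: recz_mul; first by apply: recz_sign; apply: (rec_call2 _ s') => //.
  by apply: recz_nat; apply: (rec_call2 _ a').
pose B n := b' n (k n).
have rB : rec 1 (fun e => B (e 0%N)) by apply: (rec_call2 _ b').
(* For [s = A n / B n], [X n] times the error [s ^ 2 / (2 M n)] on the phase is at most [2 ^- n]. *)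
pose M n := ((`|A n|%N ^ 2 + 1) * (2 ^ n * X n))%N.
have rM : rec 1 (fun e => M (e 0%N)).
  apply: rec_mul.
    apply: rec_add (rec_const _ _); apply: rec_exp (rec_const _ _).
    exact: rec_absz.
  by apply: rec_mul => //; apply: rec_exp => //; exact: rec_const.
pose D n := (2 * M n * B n)%N.
have rD : rec 1 (fun e => D (e 0%N)).
  by apply: rec_mul => //; apply: rec_mul => //; exact: rec_const.
pose Den n := (b n n * (D n ^ 2 + `|A n| ^ 2) ^ M n)%N.
have rDen : rec 1 (fun e => Den (e 0%N)).
  apply: rec_mul; first by apply: (rec_call2 _ b).
  apply: rec_exp => //; apply: rec_add; apply: rec_exp (rec_const _ _) => //.
  exact: rec_absz.
pose Nm (c : nat -> int) n := (-1) ^+ s n n * (a n n * 2 ^ n)%N%:Z *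
   gauss_pow c (2 * M n) (D n) (A n).
have rNm c : (forall a f, rec a f -> recz a (fun e => c (f e))) ->
    recz 1 (fun e => Nm c (e 0%N)).
  move=> rc; apply: recz_mul.
    apply: recz_mul; first by apply: recz_sign; apply: (rec_call2 _ s).
    apply: recz_nat; apply: rec_mul; first by apply: (rec_call2 _ a).
    by apply: rec_exp => //; exact: rec_const.
  apply: (recz_gauss_pow c (fun n => 2 * M n)%N D A) => //.
    by apply: rec_mul => //; exact: rec_const.
  exact: recz_nat.
have M0 n : (0 < M n)%N by rewrite !muln_gt0 expn_gt0 /X !addn_gt0 !orbT.
have B0 n : (0 < B n)%N by rewrite lt0n b0'.
have D0 n : (0 < D n)%N by rewrite /D muln_gt0 muln_gt0 M0 B0.
have Den0 n : (0 < Den n)%N.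
  by rewrite muln_gt0 lt0n b0 /= expn_gt0 addn_gt0 expn_gt0 D0.
exists (fun n => Nm re_i n %/ Den n)%Z, (fun n => Nm im_i n %/ Den n)%Z.
pose psi n : R := (2 * M n)%:R * atan ((A n)%:~R / (D n)%:R).
have XB n : `|x n| <= (X n)%:R.
  have := Hx n 0%N; rewrite expr0 invr1 => H.
  have b0R : 0 < (b n 0)%:R :> R by rewrite ltr0n lt0n b0.
  have H2 : (a n 0)%:R / (b n 0)%:R <= (a n 0 %/ b n 0)%:R + 1 :> R.
    rewrite ler_pdivrMr // natr1 -natrM ler_nat mulSn addnC.
    by rewrite {1}(divn_eq (a n 0) (b n 0)) leq_add2l ltnW // ltn_mod lt0n.
  rewrite /X natrD -(subrK ((-1) ^+ s n 0 * ((a n 0)%:R / (b n 0)%:R)) (x n)).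
  apply: le_trans (ler_normD _ _) _; rewrite normrM normrX normrN1 expr1n mul1r.
  by rewrite [`|_ / _|]ger0_norm ?divr_ge0 ?ler0n //; lra.
have psiP n : (X n)%:R * `|phi n - psi n| <= 2 / 2 ^+ n.
  have p2 : 0 < 2 ^+ n :> R by rewrite exprn_gt0.
  have BR : 0 < (B n)%:R :> R by rewrite ltr0n.
  have B1 : 1 <= (B n)%:R :> R by rewrite -[1]/(1%:R) ler_nat.
  have MR : 0 < (2 * M n)%:R :> R by rewrite ltr0n muln_gt0 M0.
  pose t : R := (A n)%:~R / (B n)%:R.
  have XR : 0 < (X n)%:R :> R by rewrite ltr0n /X addn_gt0 orbT.
  have H1 : (X n)%:R * `|phi n - t| <= 1 / 2 ^+ n.
    have := Hphi n (k n); rewrite -/(B n) [X in `|_ - X|](_ : _ = t); last first.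
      by rewrite /t /A rmorphM rmorphXn rmorphN1 mulrA.
    rewrite /k exprD invfM => H.
    apply: (@le_trans _ _ ((X n)%:R * (2 ^- n * 2 ^- X n))); first by rewrite ler_pM2l.
    rewrite mulrCA mulrC mul1r ler_piMl ?invr_ge0 ?(ltW p2) //.
    by rewrite ler_pdivrMr ?exprn_gt0 // mul1r -natrX ler_nat ltnW // ltn_expl.
  have H2 : (X n)%:R * `|psi n - t| <= 1 / 2 ^+ n.
    have := angle_approx _ (M n) t (M0 n).
    have -> : t / (2 * M n)%:R = (A n)%:~R / (D n)%:R.
      by rewrite /t /D [X in _ = _ / X]natrM invfM mulrA mulrAC.
    rewrite -/(psi n) => H; apply: (@le_trans _ _ ((X n)%:R * (t ^+ 2 / (2 * M n)%:R))).
      by rewrite ler_pM2l.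
    have tA : t ^+ 2 <= (A n)%:~R ^+ 2.
      rewrite /t expr_div_n ler_pdivrMr ?exprn_gt0 // ler_peMr ?sqr_ge0 //.
      by rewrite exprn_ege1.
    have AE : (A n)%:~R ^+ 2 = (`|A n|%N ^ 2)%:R :> R.
      by rewrite natrX -[`|A n|%N%:R]/(`|A n|%N%:~R) abszE intr_norm real_normK ?num_real.
    rewrite mulrA ler_pdivrMr // mul1r ler_pdivlMl //.
    rewrite /M !natrM natrD -AE natrX.
    apply: (@le_trans _ _ (2 ^+ n * ((X n)%:R * (A n)%:~R ^+ 2))).
      by rewrite ler_pM2l // ler_pM2l.
    have : 0 <= 2 ^+ n * (X n)%:R :> R by rewrite mulr_ge0 // ltW.
    move: (2 ^+ n) (X n)%:R ((A n)%:~R ^+ 2) (sqr_ge0 ((A n)%:~R : R)) => u v w w0 uv.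
    nra.
  have := ler_normD (phi n - t) (t - psi n); rewrite addrA subrK (distrC t) => H3.
  apply: (@le_trans _ _ ((X n)%:R * (`|phi n - t| + `|psi n - t|))); first by rewrite ler_pM2l.
  lra.
have main (c : nat -> int) (c' : nat -> R) (f : R -> R) n :
  (forall j, (c j)%:~R = c' j) -> (forall u v, `|f u - f v| <= `|u - v|) ->
  (forall u, `|f u| <= 1) ->
  gauss_pow c' (2 * M n) (D n)%:R (A n)%:~R / ((D n)%:R ^+ 2 + (A n)%:~R ^+ 2) ^+ M n = f (psi n) ->
  `|x n * f (phi n) - (Nm c n %/ Den n)%Z%:~R / 2 ^+ n| <= 4 / 2 ^+ n.
  move=> cc' f_lip f_max fE.
  have p2 : 0 < 2 ^+ n :> R by rewrite exprn_gt0.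
  pose y : R := (-1) ^+ s n n * ((a n n)%:R / (b n n)%:R).
  have bR : (b n n)%:R != 0 :> R by rewrite pnatr_eq0 b0.
  have NDE : (Nm c n)%:~R / (Den n)%:R = y * f (psi n) * 2 ^+ n.
    have -> : (Nm c n)%:~R = (-1) ^+ s n n * ((a n n)%:R * 2 ^+ n) *
        gauss_pow c' (2 * M n) (D n)%:R (A n)%:~R :> R.
      rewrite {1}/Nm intrM [X in X * _ = _]intrM (intr_gauss_pow _ _ _ _ _ _ cc').
      by rewrite rmorphXn rmorphN1 -pmulrn natrM natrX.
    have -> : (Den n)%:R = (b n n)%:R * ((D n)%:R ^+ 2 + (A n)%:~R ^+ 2) ^+ M n :> R.
      rewrite natrM natrX natrD !natrX -[`|A n|%N%:R]/(`|A n|%N%:~R) abszE intr_norm.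
      by rewrite real_normK ?num_real.
    rewrite -fE /y; move: (gauss_pow _ _ _ _) (_ ^+ M n) => G E.
    rewrite invfM; ring.
  have H1 : `|(Nm c n)%:~R / (Den n)%:R - (Nm c n %/ Den n)%Z%:~R| <= 1 :> R.
    exact: floor_approx.
  have H1' : `|y * f (psi n) - (Nm c n %/ Den n)%Z%:~R / 2 ^+ n| <= 1 / 2 ^+ n :> R.
    rewrite [X in `|X|](_ : _ =
      (y * f (psi n) * 2 ^+ n - (Nm c n %/ Den n)%Z%:~R) / 2 ^+ n); last first.
      by rewrite [RHS]mulrBl mulfK // gt_eqF.
    by rewrite -NDE normrM normfV (gtr0_norm p2) ler_pM2r // invr_gt0.
  have H2 : `|x n * f (phi n) - x n * f (psi n)| <= 2 / 2 ^+ n.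
    rewrite -mulrBr normrM; apply: le_trans (psiP n).
    by apply: ler_pM => //; exact: f_lip.
  have H3 : `|x n * f (psi n) - y * f (psi n)| <= 1 / 2 ^+ n.
    rewrite -mulrBl normrM mul1r; apply: le_trans (Hx n n).
    by rewrite ler_piMr // f_max.
  have := ler_normD (x n * f (phi n) - x n * f (psi n)) (x n * f (psi n) - y * f (psi n)).
  rewrite addrA subrK => H4.
  have := ler_normD (x n * f (phi n) - y * f (psi n))
    (y * f (psi n) - (Nm c n %/ Den n)%Z%:~R / 2 ^+ n).
  rewrite addrA subrK => H5; lra.
split; [by apply: recz_divz => //; apply: rNm; exact: recz_re_i|
 by apply: recz_divz => //; apply: rNm; exact: recz_im_i|move=> n..].
- apply: (main _ re_i cos); [exact: intr_re_i|exact: cos_lip|exact: cos_max|].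
  have [|-> _ //] := gauss_pow_atan R (M n) (D n)%:R (A n)%:~R; by rewrite ltr0n D0.
- apply: (main _ im_i sin); [exact: intr_im_i|exact: sin_lip|exact: sin_max|].
  have [|_ -> //] := gauss_pow_atan R (M n) (D n)%:R (A n)%:~R; by rewrite ltr0n D0.
Qed.

(** * Binary codes and the compression of small sets of strings *)

(** By iteration [(string_code s).+1] is the binary number with digits [s], least significant first,
below a leading 1: its size and digits are those of the string. *)
Lemma string_code_cons b s :
  ((string_code (b :: s)).+1 = (string_code s).+1.*2 + b)%N.
Proof. by rewrite /= doubleS !addSn addnS. Qed.

Lemma string_code_inj : injective string_code.
Proof.
elim=> [|b s IH] [|b' s'] E; move: (congr1 succn E); rewrite ?string_code_cons.
- by [].
- by rewrite /= doubleS.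
- by rewrite /= doubleS.
move=> H; have bb' : b = b' by move: (congr1 odd H); rewrite !oddD !odd_double !oddb.
by subst b'; congr cons; apply: IH; lia.
Qed.

Lemma string_code_bounds s :
  (2 ^ size s <= (string_code s).+1 < 2 ^ (size s).+1)%N.
Proof.
elim: s => //= b s; rewrite -/(string_code s) => /andP[H1 H2].
by rewrite !expnS in H1 H2 *; case: b; lia.
Qed.

Lemma string_code_surj L j : (j < 2 ^ L)%N ->
  exists2 s, size s = L & ((string_code s).+1 = 2 ^ L + j)%N.
Proof.
elim: L j => [|L IH] j; first by rewrite expn0 ltnS leqn0 => /eqP ->; exists [::].
rewrite expnS => jL; have [|s sL sE] := IH j./2; first by lia.
exists (odd j :: s); first by rewrite /= sL.
by rewrite string_code_cons sE -{2}(odd_double_half j); lia.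
Qed.

Lemma nth_string_code s n : (n < size s)%N ->
  nth false s n = odd ((string_code s).+1 %/ 2 ^ n).
Proof.
elim: s n => // b s IH [|n] ns; rewrite string_code_cons.
  by rewrite divn1 oddD odd_double oddb.
rewrite /= IH // expnS divnMA; congr (odd (_ %/ _)).
by rewrite divn2 halfD odd_double /= doubleK; case: b {ns}; rewrite /= ?addn0.
Qed.

(** The number [m] in unary, which delimits itself, followed by the data [r]. *)
Definition header (m : nat) (r : seq bool) : seq bool := nseq m true ++ false :: r.

Lemma string_code_header m r :
  (string_code (header m r) + 2 = 2 ^ m * (2 * (string_code r).+1 + 1))%N.
Proof.
elim: m => [|m IH]; first by rewrite /= mul1n; lia.
have E := string_code_cons true (header m r).
have -> : header m.+1 r = true :: header m r by [].
by rewrite expnS -mulnA -IH; lia.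
Qed.

(** So programs made of a header and of data whose length is a function of the header form a
prefix-free set. *)
Lemma prefix_header m r m' r' : prefix (header m r) (header m' r') -> m = m'.
Proof. by elim: m m' => [|m IH] [|m'] //= /IH ->. Qed.

Section Compression.
Variables (N : nat -> nat) (bad : nat -> nat -> bool).
Hypothesis rN : rec 1 (fun e => N (e 0%N)).
Hypothesis rbad : rec 2 (fun e => bad (e 0%N) (e 1%N)).
Hypothesis few_bad : forall m,
  (#|[set t : (N m).-tuple bool | bad m (string_code t)]| <= 2 ^ (N m - 2 * m))%N.

(** Codes of the bad strings of length [N m]. *)
Let S m y := [&& 2 ^ N m <= y.+1, y.+1 < 2 ^ (N m).+1 & bad m y]%N.
Let rank m y := (\sum_(z < y) S m z)%N.
(** The code of [header m r], where [r] is the string of length [N m - 2 * m] whose code is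
[2 ^ (N m - 2 * m) - 1 + rank m y]. *)
Let prog m y := (2 ^ m * (2 * (2 ^ (N m - 2 * m) + rank m y) + 1) - 2)%N.
(** The bound on [m] is harmless, as [m] is at most the code of a string with [m] leading [true]; it
makes the existential decidable. *)
Let decodes y p := [exists m : 'I_p.+1, S m y && (prog m y == p)].

Lemma rec_decodes : rec 2 (fun e => decodes (e 0%N) (e 1%N)).
Proof.
have rS a f g : rec a f -> rec a g -> rec a (fun e => S (f e) (g e)).
  apply: (rec_call2 a S).
  have rN2 : rec 2 (fun e => N (e 0%N)) by apply: (rec_call1 _ N) => //; exact: rec_arg.
  have y1 := rec_succ _ _ (rec_arg 2 1).
  apply: rec_and; last apply: rec_and => //.
    by apply: rec_leq => //; apply: rec_exp => //; exact: rec_const.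
  by apply: rec_ltn => //; apply: rec_exp; [exact: rec_const|exact: rec_succ].
have rrank a f g : rec a f -> rec a g -> rec a (fun e => rank (f e) (g e)).
  apply: (rec_call2 a rank).
  apply: (rec_sum 2 (fun e => e 1%N) (fun z e => S (e 0%N) z)); first exact: rec_arg.
  by apply: rS; exact: rec_arg.
have rprog a f g : rec a f -> rec a g -> rec a (fun e => prog (f e) (g e)).
  apply: (rec_call2 a prog).
  have rN2 : rec 2 (fun e => N (e 0%N)) by apply: (rec_call1 _ N) => //; exact: rec_arg.
  have r2 := rec_const 2 2; have r0 := rec_arg 2 0.
  apply: rec_sub => //; apply: rec_mul; first exact: rec_exp.
  apply: rec_add (rec_const _ _); apply: rec_mul => //; apply: rec_add.
    by apply: rec_exp => //; apply: rec_sub => //; exact: rec_mul.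
  by apply: rrank; exact: rec_arg.
apply: (rec_exists 2 (fun e => (e 1%N).+1)
  (fun m e => S m (e 0%N) && (prog m (e 0%N) == e 1%N))).
  exact: rec_succ (rec_arg _ _).
apply: rec_and; first by apply: rS; exact: rec_arg.
apply: rec_eqn; last exact: rec_arg.
by apply: rprog; exact: rec_arg.
Qed.

(** Strings are counted through their codes, so the rank is bounded by the number of bad strings. *)
Lemma rank_lt m y : S m y -> (rank m y < 2 ^ (N m - 2 * m))%N.
Proof.
move=> Sy; apply: leq_trans (few_bad m).
have -> : (rank m y).+1 = count (S m) (iota 0 y.+1).
  rewrite -[y.+1]addn1 iotaD count_cat /= Sy addn0 addn1; congr _.+1.
  rewrite /rank -(big_mkord xpredT (fun z => S m z : nat)) /index_iota subn0.
  by rewrite -sum1_count [RHS]big_mkcond; apply: eq_bigr => z _; case: (S m z).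
rewrite -size_filter cardE -(size_map (fun t : (N m).-tuple bool => string_code t)).
apply: uniq_leq_size; first by rewrite filter_uniq ?iota_uniq.
move=> z; rewrite mem_filter => /andP[/and3P[z1 z2 bz] _].
have [|s sN sz] := string_code_surj (N m) (z.+1 - 2 ^ N m); first by move: z2; rewrite expnS; lia.
have {}sz : string_code s = z by lia.
have Hs : size s == N m by apply/eqP.
by apply/mapP; exists (Tuple Hs); rewrite //= mem_enum inE /= sz.
Qed.

Lemma prog_header m y : S m y ->
  exists2 r, size r = (N m - 2 * m)%N & prog m y = string_code (header m r).
Proof.
move=> /rank_lt /string_code_surj[r rL rE]; exists r => //.
by rewrite /prog -rE -string_code_header addnK.
Qed.

(** Ranks increase strictly along the codes in [S m]. *)
Lemma rank_inj m y z : S m y -> S m z -> rank m y = rank m z -> y = z.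
Proof.
have lt u v : S m u -> (u < v)%N -> (rank m u < rank m v)%N.
  move=> Su uv; rewrite /rank -!(big_mkord xpredT (fun z => S m z : nat)).
  rewrite [ltnRHS](big_cat_nat (n := u)) //=; last exact: ltnW.
  rewrite -[ltnLHS]addn0 ltn_add2l big_ltn // Su; lia.
by move=> Sy Sz E; case: (ltngtP y z) => // [/(lt _ _ Sy)|/(lt _ _ Sz)]; rewrite E ltnn.
Qed.

Lemma decodes_inj y z p : decodes y p -> decodes z p -> y = z.
Proof.
move=> /existsP[m /andP[Sy /eqP py]] /existsP[m' /andP[Sz /eqP pz]].
have [r _ rE] := prog_header _ _ Sy; have [r' _ rE'] := prog_header _ _ Sz.
have H : header m r = header m' r' by apply: string_code_inj; rewrite -rE -rE' py pz.
have mm' : m = m' :> nat by apply: (prefix_header _ r _ r'); rewrite H prefix_refl.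
move: Sz pz; rewrite -mm' => Sz pz.
apply: (rank_inj m) => //; move: (etrans py (esym pz)); rewrite /prog.
set L := (2 ^ (N m - _))%N; have : (0 < 2 ^ m)%N by rewrite expn_gt0.
have : (0 < L)%N by rewrite expn_gt0.
move: (2 ^ m)%N L (rank m y) (rank m z) => a L u v L0 a0 E.
have : (a * (2 * (L + u) + 1) = a * (2 * (L + v) + 1))%N by nia.
by move/eqP; rewrite eqn_pmul2l // => /eqP; lia.
Qed.

(** The machine need not decode its program: it searches for a code [y] in some [S m] whose program
is the given one. *)
Lemma compressor : exists2 M, prefix_free_machine M &
  forall m s, size s = N m -> bad m (string_code s) ->
    exists2 p, machine_output M p s & size p = (m + (N m - 2 * m).+1)%N.
Proof.
have [c Hc] := rec_neg _ _ rec_decodes.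
have cE y p : mu_eval c [:: y; p] (~~ decodes y p) by exact: (Hc [:: y; p]).
exists (Mu c).
  have out p s : machine_output (Mu c) p s -> decodes (string_code s) (string_code p).
    by move=> [H _]; move: (mu_eval_functional (cE _ _) H); case: (decodes _ _).
  move=> p q s t /out/existsP[[m _] /= /andP[Sy /eqP py]].
  move=> /out/existsP[[m' _] /= /andP[Sz /eqP pz]] pq.
  have [r rL rE] := prog_header _ _ Sy; have [r' rL' rE'] := prog_header _ _ Sz.
  have pH : p = header m r by apply: string_code_inj; rewrite -rE.
  have qH : q = header m' r' by apply: string_code_inj; rewrite -rE'.
  subst p q; have mm' := prefix_header _ _ _ _ pq.
  move/prefixP: pq => [w E]; have := congr1 size E.
  rewrite /header !size_cat !size_nseq /= rL rL' mm' => sz.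
  have /size0nil w0 : size w = 0%N by move: (m' + _)%N (size w) sz => a b; lia.
  by rewrite -/(header m' r) -/(header m' r') E w0 cats0 mm'.
move=> m s sN bs; pose y := string_code s.
have Sy : S m y by have := string_code_bounds s; rewrite sN /S bs andbT.
have [r rL rE] := prog_header _ _ Sy.
exists (header m r); last by rewrite size_cat size_nseq /= rL.
have d : decodes y (string_code (header m r)).
  have mp : (m < (string_code (header m r)).+1)%N.
    rewrite ltnS; have := string_code_header m r; have := ltn_expl m (leqnn 2).
    by have := ltn0Sn (string_code r); nia.
  by apply/existsP; exists (Ordinal mp); rewrite /= Sy rE eqxx.
split; first by have := cE y (string_code (header m r)); rewrite d.
move=> z zy; exists 0%N; have := cE z (string_code (header m r)).
case: (boolP (decodes z _)) => // /decodes_inj /(_ d) E.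
by rewrite E ltnn in zy.
Qed.

End Compression.

(** A bad initial segment has a program of length [N m - m + 1], which contradicts incompressibility
once [m] exceeds the constants of [alpha] and of the simulation by [U]. *)
Lemma KC_avoids_tests (R : realType) (U : mu_rec) (alpha : nat -> bool)
    (N : nat -> nat) (bad : nat -> nat -> bool) :
  optimal_prefix_free_machine R U -> KC R U alpha ->
  rec 1 (fun e => N (e 0%N)) -> rec 2 (fun e => bad (e 0%N) (e 1%N)) ->
  (forall m, 2 * m <= N m)%N ->
  (forall m, #|[set t : (N m).-tuple bool | bad m (string_code t)]| <=
    2 ^ (N m - 2 * m))%N ->
  exists m0, forall m, (m0 <= m)%N -> ~~ bad m (string_code (mkseq alpha (N m))).
Proof.
move=> [_ opt] [k Hk] rN rbad mN few.
have [M pfM HM] := compressor N bad rN rbad few.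
have [c Hc] := opt M pfM.
exists (k + c + 2)%N => m mm; apply/negP => bm.
have [|p Mp sp] := HM m (mkseq alpha (N m)) _ bm; first by rewrite size_mkseq.
have := le_trans (Hk (N m)) (Hc (mkseq alpha (N m))).
have cM : (complexity R M (mkseq alpha (N m)) <= (size p)%:R%:E)%E.
  by apply: ereal_inf_lbound; exists p.
move=> /le_trans /(_ (leeD2r _ cM)); rewrite -EFinD lee_fin sp.
rewrite lerBlDr -!natrD ler_nat; have := mN m; lia.
Qed.

(** * A test on the fourth moments *)

Lemma energyZ (R : comPzRingType) (c : R) U V N :
  energy (fun n => c * U n) (fun n => c * V n) N = c ^+ 2 * energy U V N.
Proof. by rewrite /energy mulr_sumr; apply: eq_bigr => n _; ring. Qed.

Lemma quarticZ (R : comPzRingType) (c : R) U V N :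
  quartic (fun n => c * U n) (fun n => c * V n) N = c ^+ 4 * quartic U V N.
Proof.
rewrite /quartic mulr_sumr; apply: eq_bigr => k _.
have -> : sq_re (fun n => c * U n) (fun n => c * V n) k = c ^+ 2 * sq_re U V k.
  by rewrite /sq_re mulr_sumr; apply: eq_bigr => n _; ring.
have -> : sq_im (fun n => c * U n) (fun n => c * V n) k = c ^+ 2 * sq_im U V k.
  by rewrite /sq_im mulr_sumr; apply: eq_bigr => n _; ring.
by ring.
Qed.

Lemma energy_sign (R : comPzRingType) (b : nat -> bool) (U V : nat -> R) N :
  energy (fun n => sgb (b n) * U n) (fun n => sgb (b n) * V n) N = energy U V N.
Proof. by apply: eq_bigr => n _; rewrite /sgb; case: (b n); ring. Qed.

Lemma intr_energy (R : pzRingType) (U V : nat -> int) N :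
  (energy U V N)%:~R = energy (fun n => (U n)%:~R) (fun n => (V n)%:~R) N :> R.
Proof. by rewrite rmorph_sum; apply: eq_bigr => n _; rewrite rmorphD !rmorphXn. Qed.

Lemma intr_quartic (R : pzRingType) (U V : nat -> int) N :
  (quartic U V N)%:~R = quartic (fun n => (U n)%:~R) (fun n => (V n)%:~R) N :> R.
Proof.
rewrite rmorph_sum; apply: eq_bigr => k _; rewrite rmorphD !rmorphXn /= !rmorph_sum /=.
congr (_ ^+ 2 + _ ^+ 2); apply: eq_bigr => n _.
  by rewrite rmorphB !rmorphM.
by rewrite rmorphD !rmorphM.
Qed.

(** The Fejer weight [(1 - n / N) / 2 ^ n] multiplied by [N 2 ^ N], which makes it an integer; the
truncated subtraction makes it vanish for [n >= N]. *)
Definition weight (N n : nat) : int := ((N - n) * 2 ^ (N - n))%N.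

(** Digit [n] of the string with code [y]. *)
Definition code_bit (y n : nat) : bool := odd (y.+1 %/ 2 ^ n).

Definition energy_large (P Q : nat -> int) (m N : nat) : bool :=
  [&& (2 * m <= N)%N, (0 < N)%N &
    (8 ^ m * (N * 2 ^ N) ^ 2)%N%:Z <=
      energy (fun n => weight N n * P n) (fun n => weight N n * Q n) N].

(** The test at level [m] is passed by the strings [s] of length [N m], the least admissible length,
whose fourth moment exceeds [2 ^ (2m+1)] times the squared energy.  By [mean_quartic] and
Markov's inequality they are at most [2 ^ (N m - 2m)], and all quantities are recursive integers. *)
Lemma KC_quartic_bound (R : realType) (Un : mu_rec) (alpha : nat -> bool) (P Q : nat -> int) :
  optimal_prefix_free_machine R Un -> KC R Un alpha ->
  recz 1 (fun e => P (e 0%N)) -> recz 1 (fun e => Q (e 0%N)) ->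
  (forall m, exists N, energy_large P Q m N) ->
  exists m0, forall m, (m0 <= m)%N -> exists2 N, energy_large P Q m N &
    quartic (fun n => sgb (alpha n) * (weight N n * P n))
            (fun n => sgb (alpha n) * (weight N n * Q n)) N <=
    2 ^+ (2 * m).+1 *
      energy (fun n => weight N n * P n) (fun n => weight N n * Q n) N ^+ 2.
Proof.
move=> opt kc rP rQ ex_large.
pose U N n := weight N n * P n; pose V N n := weight N n * Q n.
pose N m := ex_minn (ex_large m).
have largeN m : energy_large P Q m (N m) by rewrite /N; case: ex_minnP.
pose G (b : nat -> bool) N := quartic (fun n => sgb (b n) * U N n) (fun n => sgb (b n) * V N n) N.
pose E N := energy (U N) (V N) N.
pose bad m y := 2 ^+ (2 * m).+1 * E (N m) ^+ 2 < G (code_bit y) (N m).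
(* The weights vanish from [n] on, so only the first [n] signs matter. *)
have Gext b c n : (forall k, (k < n)%N -> b k = c k) -> G b n = G c n.
  move=> bc; rewrite /G; congr (quartic _ _ _); apply/funext => k; rewrite /U /V /weight;
  by case: (ltnP k n) => [/bc -> //|/eqnP ->]; rewrite !mul0r !mulr0.
have rw a f g : rec a f -> rec a g -> recz a (fun e => weight (f e) (g e)).
  move=> rf rg; apply: recz_nat; apply: rec_mul; first exact: rec_sub.
  by apply: rec_exp; [exact: rec_const|exact: rec_sub].
have rU a f g : rec a f -> rec a g -> recz a (fun e => U (f e) (g e)).
  by move=> rf rg; apply: recz_mul; [exact: rw|exact: (recz_call1 _ P)].
have rV a f g : rec a f -> rec a g -> recz a (fun e => V (f e) (g e)).
  by move=> rf rg; apply: recz_mul; [exact: rw|exact: (recz_call1 _ Q)].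
have rE a f : rec a f -> recz a (fun e => E (f e)).
  apply: recz_call1.
  apply: (recz_sum 1 (fun e => e 0%N) (fun n e => U (e 0%N) n ^+ 2 + V (e 0%N) n ^+ 2)).
    exact: rec_arg.
  by apply: recz_add; apply: recz_exp; [apply: rU|apply: rV]; exact: rec_arg.
have rlarge a f g : rec a f -> rec a g -> rec a (fun e => energy_large P Q (f e) (g e)).
  move=> rf rg; apply: rec_and; last apply: rec_and.
  - by apply: rec_leq => //; apply: rec_mul => //; exact: rec_const.
  - by apply: rec_ltn => //; exact: rec_const.
  - apply: rec_lez; last exact: rE.
    apply: recz_nat; apply: rec_mul; first by apply: rec_exp => //; exact: rec_const.
    apply: rec_exp; last exact: rec_const.
    by apply: rec_mul => //; apply: rec_exp => //; exact: rec_const.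
have rN : rec 1 (fun e => N (e 0%N)).
  apply: (rec_search 1 _ (fun n e => energy_large P Q (e 0%N) n)).
  - by apply: rlarge; exact: rec_arg.
  - by [].
  - by move=> e k; rewrite /N; case: ex_minnP => n _ Hn /Hn.
have rsb a f g : rec a f -> rec a g -> recz a (fun e => sgb (code_bit (f e) (g e))).
  move=> rf rg; have rb : rec a (fun e => code_bit (f e) (g e)).
    apply: rec_odd; apply: rec_div; first exact: rec_succ.
    by apply: rec_exp => //; exact: rec_const.
  have := recz_sign _ _ (rec_neg _ _ rb).
  by congr recz; apply/funext => e; case: (code_bit _ _).
pose sU y M n := sgb (code_bit y n) * U M n.
pose sV y M n := sgb (code_bit y n) * V M n.
have rsU a f g h : rec a f -> rec a g -> rec a h -> recz a (fun e => sU (f e) (g e) (h e)).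
  by move=> rf rg rh; apply: recz_mul; [exact: rsb|exact: rU].
have rsV a f g h : rec a f -> rec a g -> rec a h -> recz a (fun e => sV (f e) (g e) (h e)).
  by move=> rf rg rh; apply: recz_mul; [exact: rsb|exact: rV].
have rG : recz 2 (fun e => G (code_bit (e 0%N)) (e 1%N)).
  apply: (recz_sum 2 (fun e => 2 * e 1%N)%N (fun k e =>
    sq_re (sU (e 0%N) (e 1%N)) (sV (e 0%N) (e 1%N)) k ^+ 2 +
    sq_im (sU (e 0%N) (e 1%N)) (sV (e 0%N) (e 1%N)) k ^+ 2)).
    by apply: rec_mul; [exact: rec_const|exact: rec_arg].
  have rsub := rec_sub _ _ _ (rec_arg 4 1) (rec_arg 4 0).
  apply: recz_add; apply: recz_exp.
    apply: (recz_sum 3 (fun e => (e 0%N).+1) (fun n e =>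
      sU (e 1%N) (e 2%N) n * sU (e 1%N) (e 2%N) (e 0 - n)%N -
      sV (e 1%N) (e 2%N) n * sV (e 1%N) (e 2%N) (e 0 - n)%N)).
      exact: rec_succ (rec_arg _ _).
    apply: recz_add; last apply: recz_opp.
      by apply: recz_mul; apply: rsU => //; exact: rec_arg.
    by apply: recz_mul; apply: rsV => //; exact: rec_arg.
  apply: (recz_sum 3 (fun e => (e 0%N).+1) (fun n e =>
    sU (e 1%N) (e 2%N) n * sV (e 1%N) (e 2%N) (e 0 - n)%N +
    sV (e 1%N) (e 2%N) n * sU (e 1%N) (e 2%N) (e 0 - n)%N)).
    exact: rec_succ (rec_arg _ _).
  apply: recz_add; apply: recz_mul.
  - by apply: rsU => //; exact: rec_arg.
  - by apply: rsV => //; exact: rec_arg.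
  - by apply: rsV => //; exact: rec_arg.
  - by apply: rsU => //; exact: rec_arg.
have rbad : rec 2 (fun e => bad (e 0%N) (e 1%N)).
  have rN2 : rec 2 (fun e => N (e 0%N)) by apply: (rec_call1 _ N) => //; exact: rec_arg.
  have rG2 : recz 2 (fun e => G (code_bit (e 1%N)) (N (e 0%N))).
    by apply: (recz_call2 _ (fun y n => G (code_bit y) n)) => //; exact: rec_arg.
  have rt : recz 2 (fun e => 2 ^+ (2 * e 0%N).+1 * E (N (e 0%N)) ^+ 2).
    apply: recz_mul; last by apply: recz_exp; exact: rE.
    apply: (recz_expn _ (fun=> 2)); first exact: (recz_nat _ _ (rec_const _ 2)).
    by apply: rec_succ; apply: rec_mul; [exact: rec_const|exact: rec_arg].
  have := rec_neg _ _ (rec_lez _ _ _ rG2 rt).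
  by congr rec; apply/funext => e; rewrite -ltNge.
have few m : (#|[set t : (N m).-tuple bool | bad m (string_code t)]| <= 2 ^ (N m - 2 * m))%N.
  have /and3P[mN N0 NE] := largeN m.
  have E0 : 0 < E (N m).
    by apply: lt_le_trans NE; rewrite ltz_nat muln_gt0 !expn_gt0 muln_gt0 N0 expn_gt0.
  have := mean_quartic int (N m) (U (N m)) (V (N m)).
  set S := \sum_t _; set A := [set t | _]; move=> H.
  have {}H : S <= (2 ^ N m)%:R * 2 * E (N m) ^+ 2.
    by apply: H => n /eqnP; rewrite /U /V /weight => ->; rewrite mul0r.
  have SA : (#|A|)%:R * (2 ^+ (2 * m).+1 * E (N m) ^+ 2) <= S.
    rewrite /S (bigID (mem A)) /= -[leLHS]addr0; apply: lerD; last first.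
      by apply: sumr_ge0 => t _; apply: sumr_ge0 => k _; rewrite addr_ge0 ?sqr_ge0.
    rewrite mulr_natl -sumr_const; apply: ler_sum => t; rewrite inE => /ltW /le_trans; apply.
    rewrite (Gext _ (nth false t)) // => k kN.
    by rewrite nth_string_code ?size_tuple.
  have := le_trans SA H; rewrite mulrA ler_pM2r ?exprn_gt0 //.
  rewrite -[N m in leRHS](subnK mN) expnD natrM !natrX exprS [2 * 2 ^+ _]mulrC mulrA.
  by rewrite ler_pM2r // ler_pM2r ?exprn_gt0 // -natrX ler_nat.
have mN m : (2 * m <= N m)%N by case/and3P: (largeN m).
have [m0 Hm0] := KC_avoids_tests R Un alpha N bad opt kc rN rbad mN few.
exists m0 => m /Hm0; rewrite /bad -leNgt => H; exists (N m) => //.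
apply: le_trans H; rewrite le_eqVlt; apply/orP; left; apply/eqP.
apply: Gext => k kN; rewrite /code_bit -nth_string_code ?size_mkseq //.
by rewrite nth_mkseq.
Qed.

(** * From the test to the Fejer means *)

Lemma sum_inv_pow2 (R : realType) K : \sum_(n < K) 1 / 2 ^+ n <= 2 :> R.
Proof.
suff -> : \sum_(n < K) 1 / 2 ^+ n = 2 - 2 / 2 ^+ K :> R.
  by rewrite lerBlDr lerDl divr_ge0 ?exprn_ge0.
elim: K => [|K IH]; first by rewrite big_ord0; field.
by rewrite big_ord_recr /= IH exprS; field; rewrite expf_neq0.
Qed.

Lemma partial_sums_unbounded (R : realType) (a : nat -> R) :
  (forall n, 0 <= a n) -> (\sum_(0 <= n <oo) (a n)%:E = +oo)%E ->
  forall B, exists K, B <= \sum_(n < K) a n.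
Proof.
move=> a0 aoo B; apply: contrapT => /forallNP H.
have : (\sum_(0 <= n <oo) (a n)%:E <= B%:E)%E.
  apply: lime_le; first by apply: is_cvg_nneseries => n _ _; rewrite lee_fin.
  apply: nearW => K; rewrite sumEFin lee_fin big_mkord.
  by have /negP := H K; rewrite -ltNge => /ltW.
by rewrite aoo leye_eq.
Qed.

(** The upper limit is the infimum of the suprema of the tails. *)
Lemma limn_esup_bounded (R : realType) (u : nat -> \bar R) :
  (forall n, 0 <= u n)%E -> limn_esup u <> +oo%E ->
  exists B n0, forall n, (n0 <= n)%N -> (u n <= B%:E)%E.
Proof.
move=> u0; rewrite limn_esup_lim (cvg_lim _ (@cvg_esups_inf R u)) // => H.
have [n0 Hn0] : exists n0, esups u n0 != +oo%E.
  apply: contrapT => /forallNP all_oo; apply: H.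
  apply/eqP; rewrite -leye_eq; apply: le_ereal_inf_tmp => _ [n _ <-].
  by have /negP/negPn/eqP -> := all_oo n.
have un n : (n0 <= n)%N -> (u n <= esups u n0)%E.
  by move=> nn; apply: ereal_sup_ubound; exists n.
move: Hn0 un; case: (esups u n0) => [B| |] // _ un; first by exists B, n0.
by have := le_trans (u0 n0) (un n0 (leqnn _)).
Qed.

Section Approximation.
Variables (R : realType) (x phi : nat -> R) (P Q : nat -> int).
Hypothesis Pn : forall n, `|x n * cos (phi n) - (P n)%:~R / 2 ^+ n| <= 4 / 2 ^+ n.
Hypothesis Qn : forall n, `|x n * sin (phi n) - (Q n)%:~R / 2 ^+ n| <= 4 / 2 ^+ n.

(** At [N = 2K] the Fejer weights of the first [K] terms are at least 1/2, so the energy is at least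
a quarter of the partial sum of [|w_n|^2], where [w_n = (P n + i Q n) / 2 ^ n]; and
[x n ^+ 2 <= 2 |w_n|^2 + O (2 ^- n)]. *)
Lemma energy_large_exists : (\sum_(0 <= n <oo) ((x n) ^+ 2)%:E = +oo)%E ->
  forall m, exists N, energy_large P Q m N.
Proof.
move=> xoo m.
pose r n : R := ((P n)%:~R / 2 ^+ n) ^+ 2 + ((Q n)%:~R / 2 ^+ n) ^+ 2.
have r0 n : 0 <= r n by rewrite addr_ge0 ?sqr_ge0.
have xr n : x n ^+ 2 <= 2 * r n + 64 * (1 / 2 ^+ n).
  have key (p q : R) : `|p - q| <= 4 / 2 ^+ n -> p ^+ 2 <= 2 * q ^+ 2 + 32 * (1 / 2 ^+ n).
    move=> pq; have h1 : 1 / 2 ^+ n <= 1 :> R.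
      by rewrite ler_pdivrMr ?exprn_gt0 // mul1r exprn_ege1 // ler1n.
    have h0 : 0 <= 1 / 2 ^+ n :> R by rewrite divr_ge0 ?exprn_ge0.
    have -> : p = q + (p - q) by ring.
    have : (p - q) ^+ 2 <= (4 / 2 ^+ n) ^+ 2.
      rewrite -(real_normK (num_real (p - q))); apply: lerXn2r => //.
      by rewrite nnegrE (le_trans _ pq).
    have -> : 4 / 2 ^+ n = 4 * (1 / 2 ^+ n) :> R by ring.
    move: (1 / 2 ^+ n) h0 h1 (p - q) => h h0 h1 d dh.
    have : h * h <= h by rewrite ler_piMr.
    have := sqr_ge0 (q - d); nra.
  have := key _ _ (Pn n); have := key _ _ (Qn n).
  have -> : x n ^+ 2 = (x n * cos (phi n)) ^+ 2 + (x n * sin (phi n)) ^+ 2.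
    by rewrite !exprMn -mulrDr cos2Dsin2 mulr1.
  rewrite /r; lra.
have [K0 HK0] := partial_sums_unbounded R _ (fun n => sqr_ge0 (x n)) xoo (8 * 8 ^+ m + 128).
pose K := (K0 + m.+1)%N.
have HK : 4 * 8 ^+ m <= \sum_(n < K) r n.
  have : \sum_(n < K0) x n ^+ 2 <= 2 * (\sum_(n < K0) r n) + 64 * (\sum_(n < K0) 1 / 2 ^+ n).
    by rewrite !mulr_sumr -big_split; apply: ler_sum => n _.
  have := sum_inv_pow2 R K0.
  have : \sum_(n < K0) r n <= \sum_(n < K) r n.
    by rewrite big_split_ord /= lerDl sumr_ge0.
  lra.
pose N := (2 * K)%N; exists N.
apply/and3P; split; [rewrite /N /K; lia|rewrite /N /K; lia|].
rewrite -(ler_int R) intr_energy.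
have NK : N = (K + K)%N by rewrite /N mul2n addnn.
have p0 : (0 : R) < (N * 2 ^ N)%:R by rewrite ltr0n muln_gt0 expn_gt0 /N /K; lia.
rewrite -pmulrn natrM natrX natrX.
apply: (@le_trans _ _ (\sum_(n < K) (N * 2 ^ N)%:R ^+ 2 / 4 * r n)).
  rewrite -mulr_sumr; have : 0 < (N * 2 ^ N)%:R ^+ 2 :> R by rewrite exprn_gt0.
  move: HK; move: (_ ^+ 2) (\sum_(n < K) _) (8 ^+ m) => a b c; nra.
apply: (@le_trans _ _ (\sum_(n < K)
    (((weight N n * P n)%:~R : R) ^+ 2 + (weight N n * Q n)%:~R ^+ 2))).
  apply: ler_sum => n _.
  have -> : ((weight N n * P n)%:~R : R) ^+ 2 + (weight N n * Q n)%:~R ^+ 2 =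
      ((N - n) * 2 ^ N)%:R ^+ 2 * r n.
    have nN : (n <= N)%N by have := ltn_ord n; lia.
    have -> : ((N - n) * 2 ^ N)%:R = (weight N n)%:~R * 2 ^+ n :> R.
      by rewrite /weight -pmulrn -natrX -natrM -mulnA -expnD subnK.
    by rewrite /r !intrM; field; rewrite expf_neq0.
  apply: ler_wpM2r => //.
  rewrite ler_pdivrMr // -[4](_ : 2 ^+ 2 = 4 :> R); last by ring.
  rewrite -exprMn; apply: lerXn2r; rewrite ?nnegrE ?ler0n ?mulr_ge0 ?ler0n //.
  rewrite -natrM ler_nat mulnAC leq_mul2r; apply/orP; right.
  by have := ltn_ord n; lia.
pose f k : R := (weight N k * P k)%:~R ^+ 2 + (weight N k * Q k)%:~R ^+ 2.
change (\sum_(n < K) f n <= \sum_(n < N) f n).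
rewrite NK [leRHS]big_split_ord /= lerDl sumr_ge0 // => n _.
by rewrite addr_ge0 ?sqr_ge0.
Qed.

(** The term [n] is off by at most [8 / 2 ^ n]. *)
Lemma sigma_approx alpha N t : (0 < N)%N ->
  `|trig_re (fun n => (N * 2 ^ N)%:R^-1 * (sgb (alpha n) * (weight N n * P n))%:~R)
            (fun n => (N * 2 ^ N)%:R^-1 * (sgb (alpha n) * (weight N n * Q n))%:~R) N t
    - sigma x phi alpha N t| <= 16.
Proof.
move=> N0.
rewrite /sigma big_mkord big_ord_recr /= divff ?pnatr_eq0 -?lt0n // subrr !mul0r addr0.
rewrite /trig_re -sumrB; apply: le_trans (ler_norm_sum _ _ _) _.
apply: (@le_trans _ _ (\sum_(n < N) 8 * (1 / 2 ^+ n))); last first.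
  rewrite -mulr_sumr; have := sum_inv_pow2 R N; lra.
apply: ler_sum => n _.
have nN := ltn_ord n.
have wE (p : int) : (N * 2 ^ N)%:R^-1 * (sgb (alpha n) * (weight N n * p))%:~R =
    (1 - n%:R / N%:R) * rademacher R alpha n * (p%:~R / 2 ^+ n).
  have -> : (sgb (alpha n) * (weight N n * p))%:~R =
     rademacher R alpha n * (((N%:R - n%:R) * 2 ^+ (N - n)) * p%:~R).
    rewrite !intrM /weight -pmulrn natrM natrX natrB ?(ltnW nN) //.
    by rewrite /rademacher /sgb; case: (alpha n); rewrite ?rmorphN1.
  have -> : (N * 2 ^ N)%:R = N%:R * (2 ^+ (N - n) * 2 ^+ n) :> R.
    by rewrite -exprD subnK ?(ltnW nN) // natrM natrX.
  by field; rewrite !expf_neq0 // pnatr_eq0 -lt0n N0.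
rewrite !wE cosD.
set a := (1 - _) * _; set c := cos (_ * _); set s := sin (_ * _).
rewrite [X in `|X|](_ : _ = a * (- (x n * cos (phi n) - (P n)%:~R / 2 ^+ n) * c +
   (x n * sin (phi n) - (Q n)%:~R / 2 ^+ n) * s)); last by ring.
have a1 : `|a| <= 1.
  rewrite normrM; have -> : `|rademacher R alpha n| = 1.
    by rewrite /rademacher; case: (alpha n); rewrite ?normrN normr1.
  have q0 : 0 <= n%:R / N%:R :> R by rewrite divr_ge0 ?ler0n.
  have q1 : n%:R / N%:R <= 1 :> R by rewrite ler_pdivrMr ?ltr0n // mul1r ler_nat ltnW.
  by rewrite mulr1 ger0_norm; lra.
rewrite normrM; apply: (@le_trans _ _ (1 * (4 / 2 ^+ n + 4 / 2 ^+ n))); last by lra.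
apply: ler_pM => //; apply: le_trans (ler_normD _ _) _.
apply: lerD; rewrite normrM ?normrN; rewrite -[leRHS]mulr1; apply: ler_pM => //.
- exact: cos_max.
- exact: sin_max.
Qed.

End Approximation.

(** * The theorem *)

Lemma continuous_sigma (R : realType) (x phi : nat -> R) alpha N :
  continuous (sigma x phi alpha N).
Proof.
have ccos n : continuous (fun t : R => cos (2 * pi * n%:R * t + phi n)).
  move=> t; apply: (@continuous_comp _ _ _ (fun t => 2 * pi * n%:R * t + phi n));
    last exact: continuous_cos.
  by apply: cvgD; [exact: mulrl_continuous|exact: cvg_cst].
exact: (sumf_continuous R nat (index_iota 0 N.+1) _ (fun n => cstMf_continuous R _ _ (ccos n))).
Qed.

Theorem theorem3p1 (R : realType) (U : mu_rec)
  (U_optimal : optimal_prefix_free_machine R U)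
  (x phi : nat -> R)
  (x_computable : computable_sequence x)
  (phi_computable : computable_sequence phi)
  (x_not_l2 : (\sum_(0 <= n <oo) ((x n) ^+ 2)%:E = +oo)%E)
  (alpha : nat -> bool) (alpha_KC : KC R U alpha) :
  limn_esup (fun N : nat =>
    (\int[@lebesgue_measure R]_(t in `[0%R, 1%R])
       `|sigma x phi alpha N t|%:E)%E) = +oo%E.
Proof.
have [P [Q [rP rQ Pn Qn]]] := computable_polar R x phi x_computable phi_computable.
have ex_large := energy_large_exists R x phi P Q Pn Qn x_not_l2.
have [m0 Hm0] := KC_quartic_bound R U alpha P Q U_optimal alpha_KC rP rQ ex_large.
apply: contrapT => /limn_esup_bounded[N|B [n0 HB]].
  by apply: integral_ge0 => t _; rewrite lee_fin.
have csigma N := continuous_sigma R x phi alpha N.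
pose mu := @lebesgue_measure R.
have RB N : (n0 <= N)%N -> \int[mu]_(t in `[0, 1]) `|sigma x phi alpha N t| <= B.
  move=> /HB; have : (0 <= \int[mu]_(t in `[0%R, 1%R]) (`|sigma x phi alpha N t|%R)%:E)%E.
    by apply: integral_ge0 => t _; rewrite lee_fin.
  by rewrite /Rintegral -/mu; case: (\int[mu]_(t in _) _)%E.
have B0 : 0 <= B.
  by apply: le_trans (RB n0 (leqnn _)); apply: Rintegral_ge0 => t _; exact: normr_ge0.
(* Bounds the [L^1] norms of the sums with rational coefficients. *)
pose C := B + 16; have C0 : 0 < C by rewrite /C; lra.
pose W : R := (Q 0%N)%:~R ^+ 2; have W0 : 0 <= W by exact: sqr_ge0.
have [m1 Hm1] : exists m1 : nat, 4 * W + 1000 * C ^+ 2 <= m1%:R.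
  exists (Num.truncn (4 * W + 1000 * C ^+ 2)).+1.
  by apply: ltW; apply: truncnS_gt.
pose m := (m0 + n0 + m1)%N.
have [|N /and3P[mN N0 NE]] := Hm0 m; first by rewrite /m; lia.
set E := energy _ _ _ in NE *; set G := quartic _ _ _ => GE.
pose k : R := (N * 2 ^ N)%:R.
have k0 : 0 < k by rewrite ltr0n muln_gt0 expn_gt0 N0.
pose u n : R := k^-1 * (sgb (alpha n) * (weight N n * P n))%:~R.
pose v n : R := k^-1 * (sgb (alpha n) * (weight N n * Q n))%:~R.
have energyE : energy u v N = E%:~R / k ^+ 2.
  by rewrite /u /v energyZ -(intr_energy R (fun n => sgb (alpha n) * (weight N n * P n))
    (fun n => sgb (alpha n) * (weight N n * Q n))) energy_sign exprVn mulrC.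
have quarticE : quartic u v N = G%:~R / k ^+ 4.
  by rewrite /u /v quarticZ -(intr_quartic R (fun n => sgb (alpha n) * (weight N n * P n))
    (fun n => sgb (alpha n) * (weight N n * Q n))) exprVn mulrC.
have e_large : 8 ^+ m <= energy u v N.
  rewrite energyE ler_pdivlMr ?exprn_gt0 //.
  by move: NE; rewrite -(ler_int R) -pmulrn natrM [(8 ^ m)%:R]natrX [(_ ^ 2)%:R]natrX.
have q_small : quartic u v N <= 2 ^+ (2 * m).+1 * energy u v N ^+ 2.
  rewrite energyE quarticE ler_pdivrMr ?exprn_gt0 //.
  have -> : 2 ^+ (2 * m).+1 * (E%:~R / k ^+ 2) ^+ 2 * k ^+ 4 = 2 ^+ (2 * m).+1 * E%:~R ^+ 2.
    by rewrite -mulrA; congr (_ * _); rewrite expr_div_n -exprM divfK // expf_neq0 // gt_eqF.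
  by move: GE; rewrite -(ler_int R) intrM !rmorphXn.
have L1 : \int[mu]_(t in `[0, 1]) `|trig_re u v N t| <= C.
  have ct := normf_continuous R _ (continuous_trig_re R u v N).
  have cs := normf_continuous R _ (csigma N).
  apply: (@le_trans _ _ (\int[mu]_(t in `[0, 1]) (`|sigma x phi alpha N t| + 16))).
    apply: le_Rint01 => [//||t]; first by apply: addf_continuous => // t; exact: cvg_cst.
    have := sigma_approx R x phi P Q Pn Qn alpha N t N0.
    have := ler_normD (sigma x phi alpha N t) (trig_re u v N t - sigma x phi alpha N t).
    by rewrite addrC subrK; rewrite -/(u _); lra.
  rewrite Rint01D //; last by move=> t; exact: cvg_cst.
  rewrite Rint01_cst /C lerD2r; apply: RB; rewrite /m in mN; lia.
have vanish (p : nat -> int) n : (N <= n)%N ->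
    k^-1 * (sgb (alpha n) * (weight N n * p n))%:~R = 0 :> R.
  by move=> /eqnP Nn; rewrite /weight Nn mul0r mulr0 mulr0.
have v0 : v 0%N ^+ 2 = W.
  rewrite /v /W /weight subn0 !intrM -pmulrn -/k mulrCA mulKf ?gt_eqF //.
  by rewrite exprMn /sgb; case: (alpha 0%N); rewrite ?rmorphN1 ?sqrrN expr1n mul1r.
(* With this value of [l] the [L^1] term of [energy_le_L1] is an eighth of the energy, and the other
one is at most [128 C ^ 2 4 ^ m], negligible with respect to the energy, which exceeds [8 ^ m]. *)
have l0 : 0 < energy u v N / (8 * C).
  by rewrite divr_gt0 ?mulr_gt0 // (lt_le_trans _ e_large) // exprn_gt0.
have := energy_le_L1 R u v N (vanish P) (vanish Q) _ N0 l0.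
rewrite v0; move: l0 e_large q_small.
move: (energy u v N) (quartic u v N) => e q l0 e_large q_small.
have e0 : 0 < e by rewrite (lt_le_trans _ e_large) // exprn_gt0.
set I := (\int[_]_(_ in _) _)%R in L1 *; move=> main.
have p4 : 1 <= 4 ^+ m :> R by rewrite exprn_ege1 // ler1n.
have m1m : 4 * W + 1000 * C ^+ 2 <= 2 ^+ m.
  apply: le_trans Hm1 _; rewrite -natrX ler_nat ltnW //.
  by rewrite (leq_ltn_trans _ (ltn_expl m (leqnn 2))) // leq_addl.
have e_big : 4 ^+ m * (4 * W + 1000 * C ^+ 2) <= e.
  apply: le_trans e_large; have -> : 8 = 4 * 2 :> R by ring.
  by rewrite exprMn ler_pM2l // exprn_gt0.
have t1 : e / (8 * C) * I <= e / 8.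
  apply: (@le_trans _ _ (e / (8 * C) * C)); first by rewrite ler_pM2l.
  by rewrite le_eqVlt; apply/orP; left; apply/eqP; field; rewrite gt_eqF.
have t2 : q / (e / (8 * C)) ^+ 2 <= 128 * C ^+ 2 * 4 ^+ m.
  rewrite ler_pdivrMr ?exprn_gt0 //; apply: le_trans q_small _.
  have -> : 2 ^+ (2 * m).+1 = 2 * 4 ^+ m :> R.
    by rewrite exprS exprM (_ : 2 ^+ 2 = 4) //; ring.
  by rewrite le_eqVlt; apply/orP; left; apply/eqP; field; rewrite gt_eqF.
have u0 : 0 <= u 0%N ^+ 2 by exact: sqr_ge0.
have := sqr_ge0 C; have C2 : 0 < C ^+ 2 by rewrite exprn_gt0.
have : 0 <= (4 ^+ m - 1) * W by rewrite mulr_ge0 // subr_ge0.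
have : 0 < 4 ^+ m * C ^+ 2 by rewrite mulr_gt0 // (lt_le_trans ltr01).
move: e_big t1 t2 main u0; move: (e / _ * I) (q / _) (4 ^+ m) (C ^+ 2) (u 0%N ^+ 2) p4 C2.
move=> a b f c u2; nra.
Qed.
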